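(* Let $n \ge 1$ and $d \ge 0$ be integers. There exists a unique polynomial $J^*_{n,d} \in \mathbb{Z}[\mathbf u][\mathbf x]$ with the following two properties: \begin{enumerate} \item[(a)] $J_{n,d} = d\, J^*_{n,d}$. \item[(b)] For any field $K$ and any rational map $f = [F] \in \mathrm{Rat}^n_d(K)$ defined over $K$, \[C_f = V(J^*_F) \smallsetminus I_f\] as schemes, where $J^*_F := \theta_F(J^*_{n,d})$ is the specialization of $J^*_{n,d}$ at $F$ via the ring homomorphism $\theta_F : \mathbb{Z}[\mathbf u][\mathbf x] \to K[\mathbf x]$ fixing each $x_j$ and sending $u_{i,\alpha} \mapsto F_{i,\alpha}$, the coefficient of $x^\alpha$ in $F_i$. \end{enumerate}
   Context: Notation: $\mathbf x=(x_0,\ldots,x_n)$, and $\mathbf u=(u_{i,\alpha})$ are indeterminates indexed by $0\le i\le n$ and multi-indices $\alpha\in\mathbb{N}^{n+1}$ with $|\alpha|=d$. The universal tuple is $F_i^{\mathrm{univ}} := \sum_{|\alpha|=d} u_{i,\alpha}x^\alpha \in \mathbb{Z}[\mathbf u][\mathbf x]$ ($0\le i\le n$), and $J_{n,d} := \det\left(\partial F_i^{\mathrm{univ}}/\partial x_j\right)_{0\le i,j\le n}\in\mathbb{Z}[\mathbf u][\mathbf x]$ is the generic homogeneous Jacobian determinant. $\mathrm{Rat}^n_d(K)$ is the set of classes $[F]=[F_0:\ldots:F_n]$ (up to nonzero scaling) of tuples of forms of degree $d$ in $K[\mathbf x]$, not all zero and with no nonconstant common factor; $[F]$ is identified with the rational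 map $f:\mathbb{P}^n\dashrightarrow\mathbb{P}^n$, $x\mapsto[F_0(x):\ldots:F_n(x)]$. Its indeterminacy locus is $I_f = V_{\mathbb{P}^n}(F_0,\ldots,F_n)$, the complement of the maximal domain of definition of $f$. $V(\cdot)$ denotes vanishing scheme in $\mathbb{P}^n_K$, and $V(J^*_F)\smallsetminus I_f$ is the open subscheme of $V(J_F^* )$ obtained by removing $I_f$. Critical scheme: for a morphism $f: X \to Y$ of nonsingular varieties over $K$ of the same dimension $r$, there is an induced homomorphism of vector bundles $f^*(T^*Y)\to T^*X$ and, dually, the differential $f': TX \to f^*(TY)$, a homomorphism of rank-$r$ vector bundles on $X$. The critical scheme $C_f$ is the zero scheme of $\det f'$: the closed subscheme of $X$ which on each open set trivializing both bundles is defined by the determinant of a matrix representing $f'$. For a rational map $f:X\dashrightarrow Y$ with maximal domain of definition $U$, $C_f := C_{f|_U}\subseteq U$. *)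

(* Defs.v *)
From HB Require Import structures.
From mathcomp Require Import all_boot all_order all_algebra.
From mathcomp Require Export mpoly.

Set Implicit Arguments.
Unset Strict Implicit.
Unset Printing Implicit Defensive.

Import GRing.Theory.
Local Open Scope ring_scope.

(* The indeterminates u_(i, alpha) are indexed by a finite type, which is
   enumerated because {mpoly _[N]} has its variables numbered by 'I_N.  *)
Definition uidx (n d : nat) : finType :=
  ('I_n.+1 * {m : 'X_{1..n.+1 < d.+1} | mdeg m == d})%type.

Definition Zu (n d : nat) : comNzRingType := {mpoly int[#|uidx n d|]}.

Definition uvar (n d : nat) (k : uidx n d) : Zu n d := 'X_(enum_rank k).

Definition Funiv (n d : nat) (i : 'I_n.+1) : {mpoly (Zu n d)[n.+1]} :=
  \sum_(m : {m : 'X_{1..n.+1 < d.+1} | mdeg m == d})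
     uvar (i, m) *: 'X_[val m].

Definition Jgen (n d : nat) : {mpoly (Zu n d)[n.+1]} :=
  \det (\matrix_(i < n.+1, j < n.+1) (Funiv d i)^`M(j)).

Section RationalMaps.
Variables (K : fieldType) (n : nat).
Local Notation R := {mpoly K[n.+1]}.
Local Notation L := {fraction R}.
Local Notation "x %:F" := (FracField.tofrac x).

(* The forms F_0, ..., F_n represent an element of Rat^n_d(K). *)
Definition is_rat (d : nat) (F : (n.+1).-tuple R) : Prop :=
  [/\ forall i, tnth F i \is d.-homog,
      exists i, tnth F i != 0
    & forall p : R, (forall i, exists c : R, tnth F i = c * p) ->
        exists a : K, p = a%:MP].

Definition theta (d : nat) (F : (n.+1).-tuple R)
    (P : {mpoly (Zu n d)[n.+1]}) : R :=
  map_mpoly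
    (mmap (intr : int -> K)
       (fun k => let u := enum_val k in
                 (tnth F u.1)@_(val (val u.2)))) P.

(* A nonempty basic open D_+(h) of P^n = Proj K[x], given by an equation h.
   It is affine, and all coordinate rings of such opens are viewed inside the
   fraction field of K[x]; restriction maps are then inclusions.  *)
Record basic_open := BasicOpen {
  eqn : R;
  eqn_deg : nat;
  eqn_deg_gt0 : (0 < eqn_deg)%N;
  eqn_neq0 : eqn != 0;
  eqn_homog : eqn \is eqn_deg.-homog }.

(* O(D_+(h)): the degree-zero part of K[x]_h. *)
Definition regular (W : basic_open) (s : L) : Prop :=
  exists k (g : R), g \is (k * eqn_deg W).-homog /\ s = g%:F / (eqn W)%:F ^+ k.

(* D_+(h) is contained in D_+(p) iff h lies in the radical of (p). *)
Definition sub_nonvanishing (W : basic_open) (p : R) : Prop :=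
  exists k (c : R), eqn W ^+ k = c * p.

Definition sub_open (W' W : basic_open) : Prop := sub_nonvanishing W' (eqn W).

(* W is contained in P^n \ I_f, i.e. W does not meet V(F_0, ..., F_n). *)
Definition sub_domain (F : (n.+1).-tuple R) (W : basic_open) : Prop :=
  exists k (c : 'I_n.+1 -> R), eqn W ^+ k = \sum_i c i * tnth F i.

(* f(W) is contained in V. *)
Definition maps_into (F : (n.+1).-tuple R) (W V : basic_open) : Prop :=
  sub_nonvanishing W (eqn V \mPo F).

(* Graph of the comorphism f^# : O(V) -> O(W), for f(W) contained in V. *)
Definition comorphism (F : (n.+1).-tuple R) (V : basic_open) (a a' : L) : Prop :=
  exists k (g : R),
    [/\ g \is (k * eqn_deg V).-homog,
        a = g%:F / (eqn V)%:F ^+ k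
      & a' = (g \mPo F)%:F / (eqn V \mPo F)%:F ^+ k].

(* Graph of the identity of O(W). *)
Definition id_regular (W : basic_open) (a a' : L) : Prop :=
  regular W a /\ a' = a.

(* K-derivations A -> O(W), where O(W) is an A-module through the ring
   homomorphism A -> O(W) whose graph is phi.  For phi = id_regular W these
   are the sections of T P^n over W; for phi = comorphism F V they are the
   sections over W of f^*(T P^n), that is, of the dual of f^*(T^* P^n).
   Only the values of E on A matter.  *)
Definition is_derivation (phi : L -> L -> Prop) (W : basic_open) (E : L -> L)
    : Prop :=
  [/\ forall a a', phi a a' -> regular W (E a),
      forall c : K, E (c%:MP)%:F = 0,
      forall a a' b b', phi a a' -> phi b b' -> E (a + b) = E a + E b
    & forall a a' b b', phi a a' -> phi b b' ->
        E (a * b) = a' * E b + b' * E a].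

(* B is a basis of the O(W)-module of derivations along phi, i.e. a
   trivialization over W of the corresponding rank n bundle.  *)
Definition is_frame (phi : L -> L -> Prop) (W : basic_open)
    (B : 'I_n -> L -> L) : Prop :=
  (forall i, is_derivation phi W (B i)) /\
  (forall E, is_derivation phi W E ->
     exists! c : 'rV[L]_n,
       (forall i, regular W (c 0 i)) /\
       (forall a a', phi a a' -> E a = \sum_i c 0 i * B i a)).

(* M is the matrix, in the frames D of TX and E of f^*(TY) over W, of the
   differential f' : TX -> f^*(TY), which sends a vector field D to the
   derivation D \o f^#.  *)
Definition differential_matrix (F : (n.+1).-tuple R) (W V : basic_open)
    (D E : 'I_n -> L -> L) (M : 'M[L]_n) : Prop :=
  (forall i j, regular W (M i j)) /\
  (forall j a a', comorphism F V a a' -> D j a' = \sum_i M i j * E i a).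

(* A closed subscheme of an open subset U of P^n is given by its
   (quasi-coherent) ideal sheaf, i.e. by an ideal of O(W) for each basic open W
   contained in U; the values on the other basic opens are irrelevant. *)
Definition ideal_sheaf := basic_open -> L -> Prop.

Definition same_subscheme (U : basic_open -> Prop) (I1 I2 : ideal_sheaf) : Prop :=
  forall W, U W -> forall s, I1 W s <-> I2 W s.

(* The zero scheme of det f': a function belongs to its ideal iff it is a
   multiple of the determinant of f' on each smaller open over which both
   bundles are trivialized (such opens form a basis of the domain of f). *)
Definition critical_scheme (F : (n.+1).-tuple R) : ideal_sheaf := fun W s =>
  regular W s /\
  forall (W' V : basic_open) (D E : 'I_n -> L -> L) (M : 'M[L]_n),
    sub_open W' W -> maps_into F W' V ->
    is_frame (id_regular W') W' D ->
    is_frame (comorphism F V) W' E ->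
    differential_matrix F W' V D E M ->
    exists r : L, regular W' r /\ s = r * \det M.

(* V(p), cut out by the homogeneous ideal generated by the homogeneous
   components of p (that is, by p itself if p is homogeneous): on D_+(h), its
   ideal is the degree-zero part of the localization at h of that ideal. *)
Definition vanishing_scheme (p : R) : ideal_sheaf := fun W s =>
  exists k (c : 'I_(msize p) -> R),
    let g := \sum_(i < msize p) c i * pihomog mdeg i p in
    g \is (k * eqn_deg W).-homog /\ s = g%:F / (eqn W)%:F ^+ k.

End RationalMaps.

(* Main.v *)
(* For j in {0, ..., n} let B_j be the determinant of the Jacobian matrix of F
   with its j-th column replaced by F.  Cramer's rule and Euler's identity give
   X_j J = d B_j; hence X_i B_j = X_j B_i, X_j divides B_j, and J* is the common
   quotient B_j / X_j, so that J = d J*.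
   On a chart X_j F_i <> 0 the fields X_j d/dX_k (k <> j) and F_i d/dX_l along F
   (l <> i) are frames of TX and of f^*(TY), and a Schur complement computes the
   determinant of f' in them as (X_j / F_i)^(n+1) J*_F up to sign.  Every other
   pair of frames differs from these by invertible matrices, so the ideals of
   the two schemes agree on these charts, hence everywhere by gluing.
   If d > 0, (a) determines J*.  If d = 0 then J* = 0, and another solution
   would cut out all of P^n at the generic F over Frac Z[u], hence vanish. *)

From mathcomp Require Import all_boot all_order all_algebra.
From mathcomp Require Import ring.
From Stdlib Require Import ClassicalEpsilon.
Require Import Defs.

Set Implicit Arguments.
Unset Strict Implicit.
Unset Printing Implicit Defensive.

Import GRing.Theory.
Local Open Scope ring_scope.

(** * Determinants and homogeneous polynomials *)

(** The integer [d] may be zero in [K], and then (a) says nothing about the specialization of J*. So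
    J* is built over Z[u], a domain of characteristic 0 in which a positive [d] can be cancelled,
    and only the identities X_j J* = B_j, from which [d] has disappeared, are specialized. In
    [critical_scheme] the opens W', V and both frames are arbitrary, and X_l / X_i need not be
    regular on V. All computations therefore take place in the fraction field of K[x], where
    regularity on W splits into two conditions: the poles are cleared by a power of the equation of
    W, and the degree is zero. The second survives field operations; the first is local, so it can
    be tested where X_j F_i is invertible. *)

Lemma det_schur (A : fieldType) n (M : 'M[A]_n.+1) i j : M i j != 0 ->
  \det M = M i j * (-1) ^+ (i + j) *
    \det (\matrix_(l < n, k < n)
            (M (lift i l) (lift j k) - M (lift i l) j / M i j * M i (lift j k))).
Proof.
move=> w0.
(* Row reduction with pivot [M i j]: [T] is unipotent and subtracts [v l 0] times row [i] from row
   [l], so column [j] of [T *m M] vanishes off row [i]. *)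
pose v := \col_l (if l == i then 0 else M l j / M i j) : 'cV[A]_n.+1.
pose T := 1%:M - v *m delta_mx 0 i : 'M[A]_n.+1.
have TE l k : T l k = (l == k)%:R - v l 0 * (k == i)%:R.
  by rewrite !mxE big_ord1 !mxE eqxx andTb.
have detT : \det T = 1.
  rewrite (expand_det_row _ i) (bigD1 i) //= big1 => [|k ki]; last first.
    by rewrite TE (negPf ki) eq_sym (negPf ki) mulr0 subr0 mul0r.
  rewrite TE !eqxx mxE eqxx mul0r subr0 mul1r addr0 /cofactor addnn -mul2n exprM.
  rewrite sqrrN expr1n expr1n mul1r -[RHS](det1 A n); congr (\det _).
  apply/matrixP=> a b; rewrite [LHS]mxE [LHS]mxE TE [RHS]mxE (inj_eq (@lift_inj _ i)).
  by rewrite [lift i b == i]eq_sym (negPf (neq_lift _ _)) mulr0 subr0.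
have TM l k : (T *m M) l k = M l k - v l 0 * M i k.
  rewrite mulmxBl mul1mx -mulmxA -rowE !mxE big_ord1 !mxE.
  by [].
have -> : \det M = \det (T *m M) by rewrite det_mulmx detT mul1r.
rewrite (expand_det_col _ j) (bigD1 i) //=.
rewrite big1 => [|l li]; last first.
  by rewrite TM mxE (negPf li) divfK // subrr mul0r.
rewrite addr0 TM mxE eqxx mul0r subr0 -mulrA /cofactor; congr (_ * (_ * \det _)).
apply/matrixP=> a b; rewrite [LHS]mxE [LHS]mxE TM !mxE.
by rewrite [lift i a == i]eq_sym (negPf (neq_lift _ _)).
Qed.

Lemma mpoly_alg_ind (A : comNzRingType) n (P : {mpoly A[n]} -> Prop) :
  (forall c, P c%:MP) -> (forall i, P 'X_i) ->
  (forall p q, P p -> P q -> P (p + q)) ->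
  (forall p q, P p -> P q -> P (p * q)) -> forall p, P p.
Proof.
move=> PC PX PD PM; elim/mpolyind=> [|c m p _ _ Pp]; first by rewrite -mpolyC0.
apply: (PD) => //; rewrite -mul_mpolyC; apply: (PM) => //.
rewrite mpolyXE_id; apply: (big_ind P _ PM) => // [|i _]; first by rewrite -mpolyC1.
by elim: (m i) => [|k IH]; rewrite ?expr0 ?exprS -?mpolyC1 //; apply: PM.
Qed.

(** The component of [p * q] in degree [e0 + b] is [p] times that of [q] in degree [b], and [p]
    cancels. If [c < e0] this forces [q = 0], so the truncated subtraction is harmless. *)
Lemma homog_divisor (A : idomainType) n e0 c (p q : {mpoly A[n]}) :
  p != 0 -> p \is e0.-homog -> p * q \is c.-homog -> q \is (c - e0).-homog.
Proof.
move=> p0 hp hpq.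
have E b : pihomog mdeg (e0 + b) (p * q) = p * pihomog mdeg b q.
  rewrite {1}[q](@pihomog_partitionE _ _ mdeg (maxn (msize q) b.+1)) ?leq_maxl //.
  rewrite mulr_sumr raddf_sum /=.
  have bl : (b < maxn (msize q) b.+1)%N by rewrite leq_max ltnSn orbT.
  rewrite (bigD1 (Ordinal bl)) //= big1 => [|i ib].
    by rewrite addr0 pihomog_dE // dhomogM // pihomogP.
  apply: (@pihomog_ne0 _ _ _ (e0 + i)); last by rewrite dhomogM // pihomogP.
  by rewrite eqn_add2l; apply: contraNneq ib => e; apply/eqP/val_inj.
rewrite {1}[q](@pihomog_partitionE _ _ mdeg (msize q)) //.
apply: rpred_sum => i _; have [ic|ic] := eqVneq (e0 + i)%N c.
  by rewrite -ic addKn pihomogP.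
have /eqP: p * pihomog mdeg i q = 0 by rewrite -E (pihomog_ne0 _ hpq) // eq_sym.
by rewrite mulf_eq0 (negPf p0) /= => /eqP ->; exact: dhomog0.
Qed.

Lemma mderiv_homog (A : comNzRingType) n (p : {mpoly A[n]}) e0 k :
  p \is e0.-homog -> p^`M(k) \is e0.-1.-homog.
Proof.
move=> hp; apply/dhomogP => m; rewrite mcoeff_msupp mcoeff_deriv => h.
have : (m + U_(k))%MM \in msupp p.
  rewrite mcoeff_msupp; apply: contraNneq h => ->; by rewrite mul0rn.
move/(dhomog_mf hp) => e; have {}e : mdeg (m + U_(k)) = e0 by [].
by rewrite -e mdegD mdeg1 addn1.
Qed.

(** Coefficientwise: the [k]-th summand multiplies the coefficient of [m] by [m k], and these
    exponents add up to [mdeg m]. *)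
Lemma euler_identity (A : comNzRingType) n (p : {mpoly A[n]}) e0 :
  p \is e0.-homog -> \sum_k p^`M(k) * 'X_k = e0%:R * p.
Proof.
move=> hp; apply/mpolyP => m; rewrite raddf_sum /= mulr_natl mcoeffMn.
have [hm|hm] := eqVneq (mdeg m) e0; last first.
  rewrite (dhomog_nemf_coeff hp hm) mul0rn big1 // => k _.
  rewrite (@dhomog_nemf_coeff _ _ mdeg e0) // .
  have -> : p^`M(k) * 'X_k \is e0.-homog; last by [].
  (* In degree 0 the predecessor truncates and degrees no longer add up to [e0]; there the
     derivative is zero. *)
  case: e0 hp {hm} => [|e0] hp; last first.
    rewrite -addn1; apply: dhomogM; first exact: mderiv_homog hp.
    by rewrite dhomogX /= mdeg1.
  suff -> : p^`M(k) = 0 by rewrite mul0r dhomog0.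
  apply/mpolyP => m'; rewrite mcoeff_deriv (dhomog_nemf_coeff hp).
    by rewrite mul0rn mcoeff0.
  by rewrite /= mdegD mdeg1 addn1.
rewrite -hm mdegE -sumrMnr; apply: eq_bigr => k _.
have [mk|mk] := eqVneq (m k) 0%N.
  rewrite mk mulr0n; apply: memN_msupp_eq0; apply/negP.
  move/msuppM_le/allpairsP=> [[m1 m2]] /= [_]; rewrite msuppX inE => /eqP -> e.
  by move: mk; rewrite e mnmDE mnm1E eqxx addn1.
have e : m = (m - U_(k) + U_(k))%MM by rewrite submK // lep1mP.
have := mcoeffMX p^`M(k) U_(k) (m - U_(k)).
rewrite addmC -e => ->; rewrite mcoeff_deriv -e mnmBE mnm1E eqxx subn1 prednK //.
by rewrite lt0n.
Qed.

(** * The reduced Jacobian *)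

(** Division monomial by monomial. A monomial of [q] free of X_i would, after multiplication by X_j,
    give a monomial of ['X_i * p] still free of X_i. *)
Lemma mpolyX_dvd (A : idomainType) n (p q : {mpoly A[n]}) i j :
  i != j -> 'X_i * p = 'X_j * q -> exists r, q = 'X_i * r.
Proof.
move=> ij e; exists (\sum_(m <- msupp q) q@_m *: 'X_[m - U_(i)]).
rewrite {1}[q]mpolyE mulr_sumr big_seq [RHS]big_seq; apply: eq_bigr => m hm.
rewrite -scalerAr -mpolyXD addmC submK // lep1mP; apply/negP => /eqP mi.
have : (U_(j) + m)%MM \in msupp ('X_i * p).
  by rewrite e mcoeff_msupp mulrC mcoeffMX -mcoeff_msupp.
move/msuppM_le/allpairsP=> [[m1 m2]] /= []; rewrite msuppX inE => /eqP -> _.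
move/mnmP/(_ i); rewrite !mnmDE mi !mnm1E eqxx eq_sym (negPf ij).
by [].
Qed.

Definition cramer_mx (A : comNzRingType) n (F : 'I_n.+1 -> {mpoly A[n.+1]}) (j : 'I_n.+1) :
  'M[{mpoly A[n.+1]}]_n.+1 :=
  \matrix_(l, k) if k == j then F l else (F l)^`M(k).

(** Apply the adjugate of [J] to Euler's relation J x = d F. Entry [j] of [\adj J *m F] is the
    expansion of the Cramer determinant along its column [j]. *)
Lemma det_cramer_euler (A : comNzRingType) n (F : 'I_n.+1 -> {mpoly A[n.+1]}) d j :
  (forall i, F i \is d.-homog) ->
  'X_j * \det (\matrix_(i, k) (F i)^`M(k)) = d%:R * \det (cramer_mx F j).
Proof.
move=> hF; set J := \matrix_(i, k) _.
have -> : \det (cramer_mx F j) = (\adj J *m \col_i F i) j 0.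
  rewrite (expand_det_col _ j) mxE; apply: eq_bigr => l _.
  rewrite [X in X * _]mxE eqxx [X in _ = X * _]mxE [X in _ = _ * X]mxE mulrC.
  rewrite /cofactor.
  have -> // : col' j (cramer_mx F j) = col' j J.
  apply/matrixP=> x y; rewrite [LHS]mxE [RHS]mxE [LHS]mxE [RHS]mxE.
  by rewrite eq_sym (negPf (neq_lift _ _)).
have e : \adj J *m (J *m (\col_k 'X_k)) = d%:R *: (\adj J *m \col_i F i).
  rewrite scalemxAr; congr (_ *m _).
  apply/matrixP=> i k; rewrite !mxE -(euler_identity (hF i)).
  by apply: eq_bigr => l _; rewrite !mxE.
move/matrixP/(_ j 0): e; rewrite mulmxA mul_adj_mx mul_scalar_mx mxE mxE [RHS]mxE => <-.
by rewrite mulrC.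
Qed.

Lemma mderiv_homog0 (A : comNzRingType) n (p : {mpoly A[n]}) k :
  p \is 0.-homog -> p^`M(k) = 0.
Proof.
move=> hp; apply/mpolyP => m; rewrite mcoeff_deriv (dhomog_nemf_coeff hp).
  by rewrite mul0rn mcoeff0.
by rewrite /= mdegD mdeg1 addn1.
Qed.

Lemma det_cramer_const (A : comNzRingType) n (F : 'I_n.+1 -> {mpoly A[n.+1]}) j :
  (0 < n)%N -> (forall i, F i \is 0.-homog) -> \det (cramer_mx F j) = 0.
Proof.
case: n F j => // n F j _ hF; pose k := lift j ord0.
have kj : k != j by rewrite eq_sym neq_lift.
rewrite (expand_det_col _ k) big1 // => l _.
by rewrite mxE (negPf kj) mderiv_homog0 ?mul0r.
Qed.

Lemma swap_proportional (A : idomainType) (x y a b c e : A) :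
  e != 0 -> x * c = e * a -> y * c = e * b -> y * a = x * b.
Proof. by move=> e0 ha hb; apply: (mulfI e0); rewrite mulrCA -ha mulrCA hb mulrCA. Qed.

(** Characteristic 0 cancels [d] from X_j J = d B_j when [d > 0]; when [d = 0] the B_j vanish,
    because [0 < n] leaves a column of derivatives of constants. The bound on [n] also supplies two
    distinct variables for the divisibility argument. *)
Lemma reduced_jacobian (A : idomainType) n d (F : 'I_n.+1 -> {mpoly A[n.+1]}) :
  (0 < n)%N -> (forall k, k.+1%:R != 0 :> A) -> (forall i, F i \is d.-homog) ->
  exists J : {mpoly A[n.+1]},
    \det (\matrix_(i, k) (F i)^`M(k)) = d%:R * J /\
    forall j, 'X_j * J = \det (cramer_mx F j).
Proof.
case: n F => // n F _ charA hF.
have swap i j : 'X_i * \det (cramer_mx F j) = 'X_j * \det (cramer_mx F i).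
  case: d hF => [|d] hF.
    by rewrite !det_cramer_const // !mulr0.
  apply: swap_proportional (det_cramer_euler j hF) (det_cramer_euler i hF).
  by rewrite -mpolyC_nat mpolyC_eq0.
have X0 (i : 'I_n.+2) : 'X_i != 0 :> {mpoly A[n.+2]}.
  by rewrite -msize_poly_eq0 msizeX.
have [//|J eJ] := @mpolyX_dvd _ _ _ _ 0 1 _ (swap 0 1).
have BJ j : 'X_j * J = \det (cramer_mx F j).
  by apply: (mulfI (X0 0)); rewrite swap mulrCA -eJ.
exists J; split=> //; apply: (mulfI (X0 0)).
by rewrite (det_cramer_euler _ hF) -BJ mulrCA.
Qed.

(** * Homogeneous localization *)

(** Leibniz formula, for subrings given by a [Prop]: localizations, degree-zero fractions, and
    fractions whose poles are cleared by powers of one element. *)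
Lemma det_closed (A : comNzRingType) (P : A -> Prop) n (M : 'M[A]_n) :
  P 0 -> P 1 -> P (-1) -> (forall x y, P x -> P y -> P (x + y)) ->
  (forall x y, P x -> P y -> P (x * y)) -> (forall i j, P (M i j)) -> P (\det M).
Proof.
move=> P0 P1 PN PD PM PA; rewrite /determinant.
apply: (big_ind P) => // s _; apply: (PM); last exact: (big_ind P).
by rewrite -signr_odd; case: (odd _); rewrite ?expr0 ?expr1.
Qed.

Section Localization.
Variables (A : idomainType).
Local Notation "x %:F" := (@FracField.tofrac A x).

(** The localization A_h inside the fraction field, with the denominator cleared; [inlocP] gives the
    quotient form. *)
Definition inloc (h : A) (s : {fraction A}) : Prop :=
  exists k g, s * h%:F ^+ k = g%:F.

Lemma tofrac_neq0 (p : A) : p != 0 -> p%:F != 0.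
Proof. by rewrite tofrac_eq0. Qed.

Lemma frac_eq (a b c d : A) : b != 0 -> d != 0 ->
  a%:F / b%:F = c%:F / d%:F -> a * d = c * b.
Proof.
move=> b0 d0 e; apply/eqP; rewrite -tofrac_eq !tofracM; apply/eqP.
have := tofrac_neq0 b0; have := tofrac_neq0 d0 => d0' b0'.
by move/eqP: e; rewrite eqr_div // => /eqP.
Qed.

Variable h : A.

Lemma inlocF g : inloc h g%:F.
Proof. by exists 0, g; rewrite expr0 mulr1. Qed.

Lemma inlocD s t : inloc h s -> inloc h t -> inloc h (s + t).
Proof.
move=> [k [a ea]] [l [b eb]]; exists (k + l)%N, (a * h ^+ l + b * h ^+ k).
by rewrite tofracD !tofracM !tofracXn -ea -eb exprD; ring.
Qed.

Lemma inlocM s t : inloc h s -> inloc h t -> inloc h (s * t).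
Proof.
move=> [k [a ea]] [l [b eb]]; exists (k + l)%N, (a * b).
by rewrite tofracM -ea -eb exprD; ring.
Qed.

Lemma inlocX s k : inloc h s -> inloc h (s ^+ k).
Proof.
move=> hs; elim: k => [|k IH]; first by rewrite expr0 -tofrac1; exact: inlocF.
by rewrite exprS; apply: inlocM.
Qed.

Lemma inloc_det n (M : 'M_n) : (forall i j, inloc h (M i j)) -> inloc h (\det M).
Proof.
apply: det_closed; [ | | | exact: inlocD | exact: inlocM].
- by rewrite -tofrac0; exact: inlocF.
- by rewrite -tofrac1; exact: inlocF.
- by rewrite -tofrac1 -tofracN; exact: inlocF.
Qed.

Lemma inloc_pole_widen s p m k : inloc h (s * p%:F ^+ m) -> inloc h (s * p%:F ^+ (m + k)).
Proof.
by move=> hs; rewrite exprD mulrA; apply: inlocM hs _; rewrite -tofracXn; exact: inlocF.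
Qed.

Lemma inloc_det_pole p n (M : 'M_n) :
  (forall i j, exists m, inloc h (M i j * p%:F ^+ m)) ->
  exists m, inloc h (\det M * p%:F ^+ m).
Proof.
apply: (@det_closed _ (fun s => exists m, inloc h (s * p%:F ^+ m))).
- by exists 0; rewrite mul0r -tofrac0; exact: inlocF.
- by exists 0; rewrite mul1r expr0 -tofrac1; exact: inlocF.
- by exists 0; rewrite expr0 mulr1 -tofrac1 -tofracN; exact: inlocF.
- move=> x y [m hm] [k hk]; exists (m + k)%N; rewrite mulrDl; apply: inlocD.
    exact: inloc_pole_widen.
  by rewrite addnC; exact: inloc_pole_widen.
move=> x y [m hm] [k hk]; exists (m + k)%N; rewrite exprD mulrACA; exact: inlocM.
Qed.

Hypothesis h0 : h != 0.

Lemma inlocP s : inloc h s <-> exists k g, s = g%:F / h%:F ^+ k.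
Proof.
have h0' k : h%:F ^+ k != 0 by rewrite expf_neq0 // tofrac_neq0.
by split=> -[k [g e]]; exists k, g; rewrite -?e ?mulfK // e divfK.
Qed.

Lemma inloc_inv p k c : h ^+ k = c * p -> inloc h (p%:F)^-1.
Proof.
move=> e; exists k, c.
have : c * p != 0 by rewrite -e expf_neq0.
rewrite mulf_eq0 negb_or => /andP[_ p0].
by rewrite -tofracXn e tofracM mulrCA mulVf ?mulr1 // tofrac_neq0.
Qed.

Lemma inloc_sub p k c s : h ^+ k = c * p -> inloc p s -> inloc h s.
Proof.
move=> e [m [g em]].
have p0 : p != 0 by apply: contraTneq (expf_neq0 k h0) => p0; rewrite e p0 mulr0 negbK.
have -> : s = g%:F * p%:F^-1 ^+ m.
  by rewrite -em exprVn mulfK // expf_neq0 // tofrac_neq0.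
apply: inlocM; first exact: inlocF.
exact/inlocX/(inloc_inv e).
Qed.

(* The elements p with p^m s in A_h for some m form an ideal of A, the
   radical of the conductor of s into A_h. *)
Lemma inloc_glue (I : finType) (c q : I -> A) k s :
  h ^+ k = \sum_i c i * q i ->
  (forall i, exists m, inloc h (s * (q i)%:F ^+ m)) -> inloc h s.
Proof.
move=> e hq; pose S p := exists m, inloc h (s * p%:F ^+ m).
have S0 : S 0.
  by exists 1; rewrite tofrac0 expr1 mulr0 -tofrac0; exact: inlocF.
have SM a p : S p -> S (a * p).
  move=> [m hm]; exists m; rewrite tofracM exprMn mulrCA.
  by apply: inlocM => //; rewrite -tofracXn; exact: inlocF.
have SD p p' : S p -> S p' -> S (p + p').
  move=> [m hm] [m' hm']; exists (m + m')%N.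
  rewrite tofracD exprDn mulr_sumr; apply: (big_ind (inloc h)).
  - by rewrite -tofrac0; exact: inlocF.
  - exact: inlocD.
  move=> i _; rewrite mulrnAr -mulr_natr -tofrac1 -tofracMn.
  apply: inlocM; last exact: inlocF.
  (* Each term of the binomial expansion of (p + p')^(m + m') contains p'^m' or p^m. *)
  have [im|im] := leqP m' i.
    have -> : s * (p%:F ^+ (m + m' - i) * p'%:F ^+ i) =
              (s * p'%:F ^+ m') * (p ^+ (m + m' - i) * p' ^+ (i - m'))%:F.
      have ei : p'%:F ^+ i = p'%:F ^+ (i - m') * p'%:F ^+ m' by rewrite -exprD subnK.
      by rewrite ei tofracM !tofracXn; ring.
    by apply: inlocM => //; exact: inlocF.
  have e' : (m + m' - i = m + (m' - i))%N by rewrite addnBA // ltnW.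
  have -> : s * (p%:F ^+ (m + m' - i) * p'%:F ^+ i) =
            (s * p%:F ^+ m) * (p ^+ (m' - i) * p' ^+ i)%:F.
    by rewrite e' exprD tofracM !tofracXn; ring.
  by apply: inlocM => //; exact: inlocF.
have [m [l [g eg]]] : S (h ^+ k).
  by rewrite e; apply: (big_ind S) => // i _; apply/SM/hq.
by exists (k * m + l)%N, g; rewrite -eg tofracXn exprD exprM mulrA.
Qed.

Lemma inloc_glue2 (I J : finType) (c p : I -> A) (e q : J -> A) k l s :
  h ^+ k = \sum_i c i * p i -> h ^+ l = \sum_j e j * q j ->
  (forall i j, exists m, inloc h (s * ((p i)%:F * (q j)%:F) ^+ m)) -> inloc h s.
Proof.
move=> ep eq hpq.
apply: (@inloc_glue _ (fun x : I * J => c x.1 * e x.2) (fun x => p x.1 * q x.2) (k + l)).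
  rewrite exprD ep eq big_distrlr pair_big; apply: eq_bigr => x _ /=.
  exact: mulrACA.
by move=> [i j]; have [m hm] := hpq i j; exists m; rewrite tofracM.
Qed.
End Localization.

(** * Homogeneous fractions of degree zero: the function field of projective space *)

Section Degree0.
Variables (K : fieldType) (n : nat).
Local Notation R := {mpoly K[n.+1]}.
Local Notation L := {fraction R}.
Local Notation "x %:F" := (@FracField.tofrac R x).

Definition deg0 (s : L) : Prop :=
  exists m (a b : R), [/\ a \is m.-homog, b \is m.-homog, b != 0 & s = a%:F / b%:F].

Lemma deg0C c : deg0 (c%:MP)%:F.
Proof.
exists 0, c%:MP, 1; rewrite oner_neq0 tofrac1 divr1; split=> //; last exact: dhomog1.
by rewrite -[c%:MP]mulr1 mul_mpolyC dhomogZ // dhomog1.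
Qed.

Lemma deg0M s t : deg0 s -> deg0 t -> deg0 (s * t).
Proof.
move=> [m [a [b [ha hb b0 ->]]]] [m' [a' [b' [ha' hb' b0' ->]]]].
exists (m + m')%N, (a * a'), (b * b'); split; rewrite ?mulf_neq0 //.
- exact: dhomogM.
- exact: dhomogM.
by rewrite !tofracM invfM; ring.
Qed.

Lemma deg0D s t : deg0 s -> deg0 t -> deg0 (s + t).
Proof.
move=> [m [a [b [ha hb b0 ->]]]] [m' [a' [b' [ha' hb' b0' ->]]]].
exists (m + m')%N, (a * b' + a' * b), (b * b'); split; rewrite ?mulf_neq0 //.
- by apply: rpredD; [|rewrite addnC]; exact: dhomogM.
- exact: dhomogM.
by rewrite tofracD !tofracM addf_div ?tofrac_neq0.
Qed.

Lemma deg0V s : deg0 s -> deg0 s^-1.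
Proof.
move=> [m [a [b [ha hb b0 ->]]]]; have [->|a0] := eqVneq a 0.
  by rewrite tofrac0 mul0r invr0 -tofrac0 -mpolyC0; exact: deg0C.
by exists m, b, a; rewrite invf_div.
Qed.

Lemma deg0_det m (M : 'M_m) : (forall i j, deg0 (M i j)) -> deg0 (\det M).
Proof.
apply: det_closed; [ | | | exact: deg0D | exact: deg0M].
- by rewrite -tofrac0 -mpolyC0; exact: deg0C.
- by rewrite -tofrac1 -mpolyC1; exact: deg0C.
- by rewrite -tofrac1 -mpolyC1 -tofracN -mpolyCN; exact: deg0C.
Qed.

(** Equating g / h^k with a quotient a / b of forms of equal degree gives g b = a h^k, and a factor
    of a form is a form: the numerator [g] is automatically homogeneous. *)
Lemma regularP (W : basic_open K n) s : regular W s <-> inloc (eqn W) s /\ deg0 s.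
Proof.
have h0 := eqn_neq0 W; have hh := eqn_homog W.
split=> [[k [g [hg ->]]]|[/(inlocP h0) [k [g e]] [m [a [b [ha hb b0 es]]]]]].
  split; first by apply/(inlocP h0); exists k, g.
  exists (k * eqn_deg W)%N, g, (eqn W ^+ k); rewrite expf_neq0 // tofracXn.
  by split=> //; rewrite mulnC; exact: dhomogMn.
exists k, g; split=> //.
have eg : a * eqn W ^+ k = g * b.
  by apply: frac_eq; rewrite ?expf_neq0 // -es tofracXn.
rewrite -[(k * _)%N](addKn m); apply: (homog_divisor b0 hb).
by rewrite mulrC -eg; apply: dhomogM => //; rewrite mulnC; exact: dhomogMn.
Qed.

Lemma regular_inloc (W : basic_open K n) s : regular W s -> inloc (eqn W) s.
Proof. by case/regularP. Qed.

Lemma regular_deg0 (W : basic_open K n) s : regular W s -> deg0 s.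
Proof. by case/regularP. Qed.

Lemma regularD (W : basic_open K n) s t : regular W s -> regular W t -> regular W (s + t).
Proof.
move=> /regularP[? ?] /regularP[? ?].
by apply/regularP; split; [exact: inlocD|exact: deg0D].
Qed.

Lemma regularM (W : basic_open K n) s t : regular W s -> regular W t -> regular W (s * t).
Proof.
move=> /regularP[? ?] /regularP[? ?].
by apply/regularP; split; [exact: inlocM|exact: deg0M].
Qed.

Lemma regularC (W : basic_open K n) c : regular W (c%:MP)%:F.
Proof. by apply/regularP; split; [exact: inlocF|exact: deg0C]. Qed.

Lemma homog_lin_comb (p : R) m : p \is m.+1.-homog ->
  exists c : 'I_n.+1 -> R, p = \sum_j c j * 'X_j.
Proof.
move=> hp.
(* The induction does not respect homogeneity, so the claim is proved for any polynomial minus its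
   constant term. For products: pq - p0 q0 = (p - p0) q + p0 (q - q0). *)
have [c e] : exists c : 'I_n.+1 -> R, p - (p@_0%MM)%:MP = \sum_j c j * 'X_j.
  elim/mpoly_alg_ind: p {hp} => [c|i|p q [c ec] [c' ec']|p q [c ec] [c' ec']].
  - exists (fun _ => 0); rewrite mcoeffC eqxx mulr1 subrr big1 // => j _.
    by rewrite mul0r.
  - exists (fun j => (j == i)%:R); rewrite mcoeffX mnm1_eq0 mpolyC0 subr0.
    rewrite (bigD1 i) //= eqxx mul1r big1 ?addr0 // => j ji.
    by rewrite (negPf ji) mul0r.
  - exists (fun j => c j + c' j).
    rewrite (eq_bigr _ (fun j _ => mulrDl _ _ _)) big_split /= -ec -ec'.
    by rewrite mcoeffD mpolyCD; ring.
  exists (fun j => c j * q + c' j * (p@_0%MM)%:MP).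
  have E j : (c j * q + c' j * (p@_0%MM)%:MP) * 'X_j =
             (c j * 'X_j) * q + (c' j * 'X_j) * (p@_0%MM)%:MP by ring.
  rewrite (eq_bigr _ (fun j _ => E j)) big_split /= -!mulr_suml -ec -ec'.
  by rewrite rmorphM mpolyCM; ring.
exists c; rewrite -e (dhomog_nemf_coeff hp) ?mpolyC0 ?subr0 //.
by rewrite /= mdeg0.
Qed.

End Degree0.

(** * Derivations along a rational map *)

(** Well-definedness of the quotient rule: the last hypothesis is the derivative of
    [g * b' = g' * b], evaluated along a map. *)
Lemma quotient_rule_unique (A : fieldType) (f g g' b b' dg dg' db db' : A) :
  b != 0 -> b' != 0 -> g * b' = g' * b -> dg * b' + g * db' = dg' * b + g' * db ->
  f * (dg * b - g * db) / b ^+ 2 = f * (dg' * b' - g' * db') / b' ^+ 2.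
Proof.
move=> b0 b0' e de; rewrite -!mulrA; congr (_ * _).
apply/eqP; rewrite eqr_div ?expf_neq0 // -subr_eq0; apply/eqP.
have -> : (dg * b - g * db) * b' ^+ 2 - (dg' * b' - g' * db') * b ^+ 2 =
  b * b' * ((dg * b' + g * db') - (dg' * b + g' * db))
  - (g * b' - g' * b) * (db' * b + db * b') by ring.
by rewrite e de !subrr mulr0 mul0r subrr.
Qed.

Lemma quotient_rule_add (A : fieldType) (f g g' b b' dg dg' db db' : A) :
  b != 0 -> b' != 0 ->
  f * ((dg * b' + g * db' + (dg' * b + g' * db)) * (b * b')
       - (g * b' + g' * b) * (db * b' + b * db')) / (b * b') ^+ 2 =
  f * (dg * b - g * db) / b ^+ 2 + f * (dg' * b' - g' * db') / b' ^+ 2.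
Proof. by move=> b0 b0'; field; rewrite b0 b0'. Qed.

Lemma quotient_rule_mul (A : fieldType) (f g g' b b' dg dg' db db' : A) :
  b != 0 -> b' != 0 ->
  f * ((dg * g' + g * dg') * (b * b') - g * g' * (db * b' + b * db'))
    / (b * b') ^+ 2 =
  g / b * (f * (dg' * b' - g' * db') / b' ^+ 2)
  + g' / b' * (f * (dg * b - g * db) / b ^+ 2).
Proof. by move=> b0 b0'; field; rewrite b0 b0'. Qed.

Section Tangent.
Variables (K : fieldType) (n : nat).
Local Notation R := {mpoly K[n.+1]}.
Local Notation L := {fraction R}.
Local Notation "x %:F" := (@FracField.tofrac R x).

Section Pullback.
Variable F : (n.+1).-tuple R.

Definition pull (g : R) : L := (g \mPo F)%:F.

Lemma pullD g g' : pull (g + g') = pull g + pull g'.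
Proof. by rewrite /pull comp_mpolyD tofracD. Qed.

Lemma pullM g g' : pull (g * g') = pull g * pull g'.
Proof. by rewrite /pull rmorphM tofracM. Qed.

Lemma pullXn g k : pull (g ^+ k) = pull g ^+ k.
Proof. by rewrite /pull rmorphXn tofracXn. Qed.

Lemma pullC c : pull c%:MP = (c%:MP)%:F.
Proof. by rewrite /pull comp_mpolyC. Qed.

Lemma pull1 : pull 1 = 1.
Proof. by rewrite -mpolyC1 pullC mpolyC1 tofrac1. Qed.

Lemma pullX i : pull 'X_i = (tnth F i)%:F.
Proof. by rewrite /pull comp_mpolyXU -tnth_nth. Qed.

Lemma pull0 : pull 0 = 0.
Proof. by rewrite /pull comp_mpoly0 tofrac0. Qed.

Lemma pullE g : pull g = (g \mPo F)%:F.
Proof. by []. Qed.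

Opaque pull.

Lemma pull_neq0 g : pull g != 0 -> g != 0.
Proof. by apply: contraNneq => ->; rewrite pull0. Qed.

(** Composition with [F] on the localization of K[x] at the prime ideal of polynomials vanishing
    along [F]. Besides O(V), this ring contains X_l / X_i as soon as F_i is nonzero, even where X_l
    / X_i is not regular on V. *)
Definition pullback (a a' : L) : Prop :=
  exists g b, [/\ pull b != 0, a = g%:F / b%:F & a' = pull g / pull b].

Lemma pullback_fun a a1 a2 : pullback a a1 -> pullback a a2 -> a1 = a2.
Proof.
move=> [g [b [b0 -> ->]]] [g' [b' [b0' e ->]]]; apply/eqP.
rewrite (eqr_div _ _ b0 b0') -!pullM.
by rewrite (frac_eq (pull_neq0 b0) (pull_neq0 b0') e).
Qed.

(* The image under the Euler sequence of the vector field F_i d/dX_l along F: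
   it sends a to F_i times the l-th partial derivative of a, evaluated at F.
   Its value on a fraction whose denominator vanishes along F is junk. *)
Definition tangent (i l : 'I_n.+1) (a : L) : L :=
  epsilon (inhabits 0) (fun v => exists g b, [/\ pull b != 0, a = g%:F / b%:F &
    v = (tnth F i)%:F * (pull g^`M(l) * pull b - pull g * pull b^`M(l)) / pull b ^+ 2]).

Lemma tangentE i l g b : pull b != 0 ->
  tangent i l (g%:F / b%:F) =
  (tnth F i)%:F * (pull g^`M(l) * pull b - pull g * pull b^`M(l)) / pull b ^+ 2.
Proof.
move=> b0; rewrite /tangent; set P := (P in epsilon _ P).
have : P (epsilon (inhabits 0) P).
  by apply: epsilon_spec; exists ((tnth F i)%:F *
    (pull g^`M(l) * pull b - pull g * pull b^`M(l)) / pull b ^+ 2); exists g, b.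
case=> g' [b' [b0' e ->]].
have {}e := frac_eq (pull_neq0 b0) (pull_neq0 b0') e.
apply: (@quotient_rule_unique L _ (pull g') (pull g)).
- exact: b0'. 
- exact: b0.
- rewrite -pullM.
 rewrite -pullM.
 by rewrite e.
by rewrite -!pullM -!pullD -!mderivM e.
Qed.

Lemma tangentD i l a a' b b' : pullback a a' -> pullback b b' ->
  tangent i l (a + b) = tangent i l a + tangent i l b.
Proof.
move=> [g [q [q0 -> _]]] [g' [q' [q0' -> _]]].
have qq0 : pull (q * q') != 0 by rewrite pullM; exact: mulf_neq0 q0 q0'.
rewrite (addf_div _ _ (tofrac_neq0 (pull_neq0 q0)) (tofrac_neq0 (pull_neq0 q0'))).
rewrite -!tofracM -tofracD (tangentE _ _ _ qq0) (tangentE _ _ _ q0) (tangentE _ _ _ q0').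
rewrite mderivD !mderivM !pullD !pullM; exact: quotient_rule_add q0 q0'.
Qed.

Lemma tangentM i l a a' b b' : pullback a a' -> pullback b b' ->
  tangent i l (a * b) = a' * tangent i l b + b' * tangent i l a.
Proof.
move=> [g [q [q0 -> ->]]] [g' [q' [q0' -> ->]]].
have qq0 : pull (q * q') != 0 by rewrite pullM; exact: mulf_neq0 q0 q0'.
rewrite mulf_div -!tofracM.
rewrite (tangentE _ _ _ qq0) (tangentE _ _ _ q0) (tangentE _ _ _ q0').
rewrite !mderivM !pullD !pullM; exact: quotient_rule_mul q0 q0'.
Qed.

Lemma tangentC i l c : tangent i l (c%:MP)%:F = 0.
Proof.
rewrite -[(c%:MP)%:F]divr1 -tofrac1 tangentE ?pull1 ?oner_neq0 //.
by rewrite mderivC -mpolyC1 mderivC pull0 mul0r mulr0 subrr mulr0 mul0r.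
Qed.

(** The factor F_i in [tangent] is what makes these fields exactly dual to the affine coordinates
    X_l / X_i. *)
Lemma tangent_coord i m l : (tnth F i) != 0 ->
  tangent i (lift i m) (('X_l)%:F / ('X_i)%:F) = (l == lift i m)%:R.
Proof.
move=> Fi0; have Fi0' := tofrac_neq0 Fi0.
have Xi0 : pull 'X_i != 0 by rewrite pullX.
rewrite (tangentE _ _ _ Xi0) !pullX.
have dX k k' : pull ('X_k^`M(k')) = (k == k')%:R.
  rewrite mderivX mnm1E; case: eqP => [->|_]; last first.
    by rewrite scale0r pull0.
  have -> : (U_(k') - U_(k'))%MM = 0%MM by apply/mnmP=> x; rewrite mnmBE subnn mnm0E.
  by rewrite scale1r mpolyX0 pull1.
rewrite !dX (negPf (neq_lift _ _)) mulr0 subr0 mulrCA expr2; apply: mulfK.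
exact: (mulf_neq0 Fi0' Fi0').
Qed.

End Pullback.


Section Comorphism.
Variables (F : (n.+1).-tuple R) (d : nat).
Hypothesis homF : forall i, tnth F i \is d.-homog.

Lemma comp_homog g m : g \is m.-homog -> g \mPo F \is (d * m).-homog.
Proof.
move=> hg; rewrite comp_mpolyEX big_seq; apply: rpred_sum => mm hmm.
apply: rpredZ; rewrite comp_mpolyX.
have <- : mdeg mm = m by exact: (dhomog_mf hg).
rewrite mdegE big_distrr /=.
apply: (big_ind2 (fun (p : R) k => p \is k.-homog)) => //.
- exact: dhomog1.
- by move=> x1 k1 x2 k2; exact: dhomogM.
- by move=> i _; exact: dhomogMn.
Qed.

(** Multiplication by F_i compensates the degree lost by differentiation, so [tangent] preserves
    degree zero. *)
Lemma euler_lift_homog g m i l : g \is m.-homog ->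
  tnth F i * (g^`M(l) \mPo F) \is (d * m).-homog.
Proof.
case: m => [|m] hg; first by rewrite mderiv_homog0 // comp_mpoly0 mulr0 dhomog0.
rewrite mulnS; apply: dhomogM => //; apply: comp_homog.
exact: (mderiv_homog l hg).
Qed.

Variables (W V : basic_open K n).
Hypothesis FWV : maps_into F W V.
Local Notation q := (eqn V).

Lemma maps_into_neq0 : pull F q != 0.
Proof.
case: FWV => k [c e]; apply: contraTneq (expf_neq0 k (eqn_neq0 W)) => q0.
rewrite e negbK; move/eqP: q0; rewrite pullE tofrac_eq0 => /eqP ->.
by rewrite mulr0.
Qed.

Lemma maps_into_neq0X k : pull F (q ^+ k) != 0.
Proof. by rewrite pullXn; exact: expf_neq0 maps_into_neq0. Qed.

Lemma comorphism_pullback a a' : comorphism F V a a' -> pullback F a a'.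
Proof.
move=> [k [g [_ -> ->]]]; exists g, (q ^+ k); rewrite maps_into_neq0X pullXn.
by rewrite tofracXn.
Qed.

Lemma comorphismC c : comorphism F V (c%:MP)%:F (c%:MP)%:F.
Proof.
exists 0, c%:MP; rewrite !expr0 !divr1 comp_mpolyC; split=> //.
by rewrite mul0n -[c%:MP]mulr1 mul_mpolyC dhomogZ // dhomog1.
Qed.

Lemma comorphismD a a' b b' : comorphism F V a a' -> comorphism F V b b' ->
  comorphism F V (a + b) (a' + b').
Proof.
move=> [k [g [hg -> ->]]] [k' [g' [hg' -> ->]]].
have q0 := tofrac_neq0 (eqn_neq0 V); have Q0 := maps_into_neq0.
exists (k + k')%N, (g * q ^+ k' + g' * q ^+ k); split.
- rewrite mulnDl; apply: rpredD; last rewrite addnC.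
    by apply: dhomogM => //; rewrite mulnC; exact/dhomogMn/eqn_homog.
  by apply: dhomogM => //; rewrite mulnC; exact/dhomogMn/eqn_homog.
- rewrite (addf_div _ _ (expf_neq0 k q0) (expf_neq0 k' q0)).
  by rewrite tofracD !tofracM !tofracXn exprD.
rewrite (addf_div _ _ (expf_neq0 k Q0) (expf_neq0 k' Q0)).
by rewrite comp_mpolyD !rmorphM /= !rmorphXn /= tofracD !tofracM !tofracXn exprD.
Qed.

Lemma comorphismM a a' b b' : comorphism F V a a' -> comorphism F V b b' ->
  comorphism F V (a * b) (a' * b').
Proof.
move=> [k [g [hg -> ->]]] [k' [g' [hg' -> ->]]].
exists (k + k')%N, (g * g'); split.
- by rewrite mulnDl; exact: dhomogM.
- by rewrite mulf_div tofracM exprD.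
by rewrite mulf_div rmorphM tofracM exprD.
Qed.

Lemma comorphism_regular a a' : comorphism F V a a' -> regular W a'.
Proof.
move=> [k [g [hg _ ->]]]; apply/regularP; split.
  apply: inlocM; first exact: inlocF.
  case: FWV => m [c e]; rewrite -exprVn; apply: inlocX.
  exact: (inloc_inv (eqn_neq0 W) e).
exists (d * (k * eqn_deg V))%N, (g \mPo F), ((q \mPo F) ^+ k); split.
- exact: comp_homog.
- rewrite [(k * _)%N]mulnC mulnA; apply: dhomogMn; apply: comp_homog; exact: eqn_homog.
- by apply: expf_neq0; rewrite -tofrac_eq0; exact: maps_into_neq0.
by rewrite tofracXn.
Qed.

Lemma tangent_regular i l a a' : comorphism F V a a' -> regular W (tangent F i l a).
Proof.
move=> [k [g [hg -> _]]]; rewrite -tofracXn (tangentE _ _ _ (maps_into_neq0X k)).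
have hq : q ^+ k \is (k * eqn_deg V).-homog.
  by rewrite mulnC; exact/dhomogMn/eqn_homog.
set N := (X in X / _).
pose P := tnth F i * (g^`M(l) \mPo F) * ((q ^+ k) \mPo F) -
          (g \mPo F) * (tnth F i * ((q ^+ k)^`M(l) \mPo F)).
have eN : N = P%:F.
  rewrite /N /P !pullE tofracB !tofracM mulrBr; congr (_ - _).
    exact: mulrA.
  exact: mulrCA.
rewrite eN; apply/regularP; split.
  apply: inlocM; first exact: inlocF.
  case: FWV => m [c e]; rewrite -exprVn; apply: inlocX; rewrite pullXn -exprVn.
  apply: inlocX; exact: (inloc_inv (eqn_neq0 W) e).
set D := (d * (k * eqn_deg V))%N.
exists (D + D)%N, P, (((q ^+ k) \mPo F) ^+ 2); split.
- apply: rpredB; apply: dhomogM.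
  + exact: (euler_lift_homog i l hg).
  + exact: (comp_homog hq).
  + exact: (comp_homog hg).
  + exact: (euler_lift_homog i l hq).
- by rewrite addnn -muln2; apply: dhomogMn; exact: comp_homog.
- by apply: expf_neq0; rewrite -tofrac_eq0; exact: maps_into_neq0X.
by rewrite tofracXn.
Qed.

Lemma tangent_derivation i l :
  is_derivation (comorphism F V) W (tangent F i l).
Proof.
split.
- by move=> a a' /tangent_regular.
- exact: tangentC.
- move=> a a' b b' /comorphism_pullback ha /comorphism_pullback hb.
  exact: (tangentD _ _ ha hb).
move=> a a' b b' /comorphism_pullback ha /comorphism_pullback hb.
  exact: (tangentM _ _ ha hb).
Qed.

Lemma derivation_comb m E (B : 'I_m -> L -> L) (c : 'I_m -> L) :
  is_derivation (comorphism F V) W E ->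
  (forall i, is_derivation (comorphism F V) W (B i)) ->
  (forall i, regular W (c i)) ->
  is_derivation (comorphism F V) W (fun a => E a - \sum_i c i * B i a).
Proof.
move=> [Er EC ED EM] hB hc.
have regN s : regular W s -> regular W (- s).
  move=> hs; rewrite -mulN1r -tofrac1 -tofracN -mpolyC1 -mpolyCN.
  by apply: regularM => //; exact: regularC.
split.
- move=> a a' h; apply: regularD; first exact: Er h.
  apply: regN; apply: (big_ind (regular W)).
  + by rewrite -tofrac0 -mpolyC0; exact: regularC.
  + exact: regularD.
  by move=> i _; apply: regularM => //; case: (hB i) => Br _ _ _; exact: Br h.
- move=> x; rewrite EC big1 ?subr0 // => i _; case: (hB i) => _ -> _ _.
  by rewrite mulr0.
- move=> a a' b b' ha hb; rewrite (ED _ _ _ _ ha hb) addrACA -opprD -big_split /=.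
  congr (_ - _); apply: eq_bigr => i _; case: (hB i) => _ _ BD _.
  by rewrite (BD _ _ _ _ ha hb) mulrDr.
move=> a a' b b' ha hb; rewrite (EM _ _ _ _ ha hb) !mulrBr addrACA -opprD.
congr (_ - _); rewrite !mulr_sumr -big_split; apply: eq_bigr => i _.
case: (hB i) => _ _ _ BM; rewrite (BM _ _ _ _ ha hb) mulrDr.
by congr (_ + _); exact: mulrCA.
Qed.

(** The comorphism as a total function, so that it can be composed with a derivation; its values
    outside O(V) are junk. *)
Definition comap (a : L) : L := epsilon (inhabits 0) (comorphism F V a).

Lemma comapE a a' : comorphism F V a a' -> comap a = a'.
Proof.
move=> h; apply: pullback_fun (comorphism_pullback h).
by apply: comorphism_pullback; apply: epsilon_spec; exists a'.
Qed.

Lemma derivation_comap D : is_derivation (id_regular W) W D ->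
  is_derivation (comorphism F V) W (D \o comap).
Proof.
move=> [Dr DC DD DM].
have hid a a' : comorphism F V a a' -> id_regular W a' a'.
  by move=> /comorphism_regular h; split.
split=> [a a' h|c|a a' b b' ha hb|a a' b b' ha hb] /=.
- by rewrite (comapE h); exact: (Dr _ _ (hid _ _ h)).
- by rewrite (comapE (comorphismC _)) DC.
- rewrite (comapE ha) (comapE hb) (comapE (comorphismD ha hb)).
  exact: (DD _ _ _ _ (hid _ _ ha) (hid _ _ hb)).
rewrite (comapE ha) (comapE hb) (comapE (comorphismM ha hb)).
exact: (DM _ _ _ _ (hid _ _ ha) (hid _ _ hb)).
Qed.
End Comorphism.

End Tangent.

(** * Frames *)

Lemma frac_cancel (A : fieldType) (x y c : A) : c != 0 -> x / y = x * c / (c * y).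
Proof. by move=> c0; rewrite [c * y]mulrC -mulf_div divff // mulr1. Qed.

Lemma frac_rescale (A : fieldType) (a b p q : A) : b != 0 ->
  a * p / q = a / b * (b * p / q).
Proof. by move=> b0; rewrite !mulrA divfK. Qed.

Lemma quotient_rule_coord (A : fieldType) (z t v b : A) : v != 0 ->
  ((z * t + v * b) * v - z * v * t) / v ^+ 2 = b.
Proof. by move=> v0; field. Qed.

Lemma quotient_rule_scale (A : fieldType) (g a b v w : A) :
  (g * a * v - w * (g * b)) / v ^+ 2 = g * ((a * v - w * b) / v ^+ 2).
Proof. by ring. Qed.

Lemma clear_denominator (A : fieldType) (x v w : A) : v != 0 ->
  x / v ^+ 2 * (v * w * (v * w)) = x * (w * w).
Proof. by move=> v0; field. Qed.

Section Frames.
Variables (K : fieldType) (n : nat).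
Local Notation R := {mpoly K[n.+1]}.
Local Notation L := {fraction R}.
Local Notation "x %:F" := (@FracField.tofrac R x).

Lemma mmap_tofrac_homog (g : R) m i : g \is m.-homog ->
  mmap (@FracField.tofrac R \o @mpolyC n.+1 K) (fun l => ('X_l)%:F / ('X_i)%:F) g
  = g%:F / ('X_i)%:F ^+ m.
Proof.
move=> hg; rewrite {2}[g]mpolyE /mmap raddf_sum /= mulr_suml.
rewrite big_seq [RHS]big_seq; apply: eq_bigr => mm hmm.
rewrite -mul_mpolyC tofracM -mulrA; congr (_ * _).
have <- : mdeg mm = m by exact: (dhomog_mf hg).
have eX : 'X_[mm] = \prod_(l < n.+1) 'X_l ^+ mm l :> R by exact: mpolyXE_id.
rewrite mdegE eX rmorph_prod /= /mmap1 -prodrXr -prodf_div.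
apply: eq_bigr => l _.
by rewrite tofracXn expr_div_n.
Qed.

Lemma X_neq0 (i : 'I_n.+1) : 'X_i != 0 :> R.
Proof. by rewrite -msize_poly_eq0 msizeX. Qed.

Variables (F : (n.+1).-tuple R) (d : nat).
Hypothesis homF : forall i, tnth F i \is d.-homog.
Variables (W V : basic_open K n).
Hypothesis FWV : maps_into F W V.
Local Notation q := (eqn V).
Local Notation phi := (comorphism F V).

(** * Frames over a target open contained in the chart X_i <> 0 *)

Section AdaptedFrame.
Variables (i : 'I_n.+1) (c : R).
Hypothesis qE : q = c * 'X_i.

Lemma adapted_neq0 : tnth F i != 0.
Proof.
have := maps_into_neq0 FWV; rewrite qE pullM pullX.
by apply: contraNneq => ->; rewrite tofrac0 mulr0.
Qed.

Lemma adapted_cofactor_homog : c \is (eqn_deg V).-1.-homog.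
Proof.
rewrite -subn1; apply: (homog_divisor (X_neq0 i)).
  by rewrite dhomogX /= mdeg1.
by rewrite mulrC -qE; exact: eqn_homog.
Qed.

Lemma adapted_cofactor_neq0 : pull F c != 0.
Proof.
have := maps_into_neq0 FWV; rewrite qE pullM.
by apply: contraNneq => ->; rewrite mul0r.
Qed.

Lemma adapted_coord l :
  phi (('X_l)%:F / ('X_i)%:F) ((tnth F l)%:F / (tnth F i)%:F).
Proof.
have c0 := adapted_cofactor_neq0.
exists 1, ('X_l * c); rewrite !expr1 -!pullE qE !pullM !pullX; split.
- have -> : (1 * eqn_deg V = 1 + (eqn_deg V).-1)%N.
    by rewrite mul1n add1n prednK // eqn_deg_gt0.
  apply: dhomogM; last exact: adapted_cofactor_homog.
  by rewrite dhomogX /= mdeg1.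
- rewrite !tofracM; exact: (frac_cancel _ _ (tofrac_neq0 (pull_neq0 c0))).
exact: (frac_cancel _ _ c0).
Qed.

(** A multiplier clearing denominators: it turns g / q^k into g / X_i^m, a polynomial in the
    coordinates X_l / X_i, and its nonzero image [w] can be cancelled afterwards. It lies in O(V)
    because 1 / X_i = c / q. *)
Lemma adapted_unit k :
  exists2 w, w != 0 & phi (q%:F ^+ k / ('X_i)%:F ^+ (k * eqn_deg V)) w.
Proof.
have c0 := adapted_cofactor_neq0.
set m := (k * eqn_deg V)%N.
pose g := q ^+ k * c ^+ m.
exists (pull F g / pull F q ^+ m).
  rewrite /g pullM !pullXn; apply: mulf_neq0; last first.
    by rewrite invr_eq0; exact: (expf_neq0 m (maps_into_neq0 FWV)).
  exact: (mulf_neq0 (expf_neq0 k (maps_into_neq0 FWV)) (expf_neq0 m c0)).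
exists m, g; rewrite -!pullE; split=> //.
- rewrite -[eqn_deg V]prednK ?eqn_deg_gt0 // mulnS; apply: dhomogM.
    by rewrite /m mulnC; exact/dhomogMn/eqn_homog.
  by rewrite mulnC; exact/dhomogMn/adapted_cofactor_homog.
have c0' := tofrac_neq0 (pull_neq0 c0); have X0 := tofrac_neq0 (X_neq0 i).
rewrite /g tofracM !tofracXn [in q%:F ^+ m]qE tofracM exprMn.
exact: (frac_cancel _ _ (expf_neq0 m c0')).
Qed.

Lemma derivation_zero T : is_derivation phi W T ->
  (forall l, T (('X_l)%:F / ('X_i)%:F) = 0) -> forall a a', phi a a' -> T a = 0.
Proof.
move=> [Tr TC TD TM] TX.
pose ev := mmap (@FracField.tofrac R \o @mpolyC n.+1 K) (fun l => ('X_l)%:F / ('X_i)%:F).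
(* Membership in O(V) is carried along because [T] is additive and satisfies Leibniz only there. *)
have Tev g : (exists w, phi (ev g) w) /\ T (ev g) = 0.
  elim/mpoly_alg_ind: g => [x|l|g g' [[w hw] e] [[w' hw'] e']
                               |g g' [[w hw] e] [[w' hw'] e']].
  - by rewrite /ev mmapC /= TC; split=> //; exists (x%:MP)%:F; exact: comorphismC.
  - rewrite /ev mmapX mmap1U TX; split=> //.
    by exists ((tnth F l)%:F / (tnth F i)%:F); exact: adapted_coord.
  - rewrite /ev mmapD -/ev; split.
      by exists (w + w'); exact: (comorphismD FWV hw hw').
    by rewrite (TD _ _ _ _ hw hw') e e' addr0.
  rewrite /ev rmorphM -/ev; split; first by exists (w * w'); exact: (comorphismM hw hw').
  by rewrite (TM _ _ _ _ hw hw') e e' !mulr0 addr0.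
have hqk k : q ^+ k \is (k * eqn_deg V).-homog.
  by rewrite mulnC; exact/dhomogMn/eqn_homog.
move=> a a' haa; have [k [g [hg ea _]]] := haa.
have [w w0 hw] := adapted_unit k.
rewrite -tofracXn -(mmap_tofrac_homog i (hqk k)) -/ev in hw.
have /(TM _ _ _ _ haa) : phi (ev (q ^+ k)) w by [].
have -> : a * ev (q ^+ k) = ev g.
  rewrite /ev (mmap_tofrac_homog i hg) (mmap_tofrac_homog i (hqk k)) ea tofracXn.
  by rewrite mulrA (divfK (expf_neq0 k (tofrac_neq0 (eqn_neq0 V)))).
rewrite (Tev g).2 (Tev (q ^+ k)).2 mulr0 add0r => /esym/eqP.
by rewrite mulf_eq0 (negPf w0) => /eqP.
Qed.

Lemma tangent_adapted_coord m l :
  tangent F i (lift i m) (('X_l)%:F / ('X_i)%:F) = (l == lift i m)%:R.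
Proof. exact: (tangent_coord _ _ adapted_neq0). Qed.

Lemma derivation_expand E : is_derivation phi W E -> forall a a', phi a a' ->
  E a = \sum_m E (('X_(lift i m))%:F / ('X_i)%:F) * tangent F i (lift i m) a.
Proof.
move=> hE a a' haa; have [Er EC _ _] := hE.
pose z l : L := ('X_l)%:F / ('X_i)%:F.
have hT := @derivation_comb _ _ F W V n E (fun m => tangent F i (lift i m))
  (fun m => E (z (lift i m))) hE (fun m => tangent_derivation homF FWV i (lift i m))
  (fun m => Er _ _ (adapted_coord _)).
have hz l : E (z l) - \sum_m E (z (lift i m)) * tangent F i (lift i m) (z l) = 0.
  case: (unliftP i l) => [m ->|->].
    rewrite (bigD1 m) //= tangent_adapted_coord eqxx mulr1 big1 ?addr0 ?subrr //.
    move=> m' m'm; rewrite tangent_adapted_coord (inj_eq (@lift_inj _ i)) eq_sym.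
    by rewrite (negPf m'm) mulr0.
  rewrite /z divff ?(tofrac_neq0 (X_neq0 i)) //.
  rewrite big1 => [|m _]; first by rewrite -tofrac1 -mpolyC1 EC subr0.
  by rewrite -tofrac1 -mpolyC1 tangentC mulr0.
by have := derivation_zero hT hz haa; move/eqP; rewrite subr_eq0 => /eqP.
Qed.

Lemma tangent_frame : is_frame phi W (fun m => tangent F i (lift i m)).
Proof.
split=> [m|E hE]; first exact: (tangent_derivation homF FWV).
have [Er _ _ _] := hE.
exists (\row_m E (('X_(lift i m))%:F / ('X_i)%:F)); split; first split.
- by move=> m; rewrite mxE; exact: (Er _ _ (adapted_coord _)).
- move=> a a' haa; rewrite (derivation_expand hE haa).
  by apply: eq_bigr => m _; rewrite mxE.
move=> c' [_ hc']; apply/rowP => m; rewrite mxE (hc' _ _ (adapted_coord _)).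
rewrite (bigD1 m) //= tangent_adapted_coord eqxx mulr1 big1 ?addr0 // => m' m'm.
by rewrite tangent_adapted_coord (inj_eq (@lift_inj _ i)) eq_sym (negPf m'm) mulr0.
Qed.
End AdaptedFrame.

(** * Arbitrary frames compared with the fields of the chart X_i <> 0 *)

Section ChangeOfFrame.
Variable i : 'I_n.+1.
Hypothesis Fi0 : tnth F i != 0.

(** Substitutes for the coordinates when V is not contained in X_i <> 0: these functions are regular
    on V, and their ratios are the X_l / X_i. *)
Definition chart_fn l : L := ('X_l * 'X_i ^+ (eqn_deg V).-1)%:F / q%:F.
Definition chart_val l : L := pull F ('X_l * 'X_i ^+ (eqn_deg V).-1) / pull F q.

Lemma chart_fnP l : phi (chart_fn l) (chart_val l).
Proof.
exists 1, ('X_l * 'X_i ^+ (eqn_deg V).-1); rewrite !expr1 -!pullE; split=> //.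
have -> : (1 * eqn_deg V = 1 + 1 * (eqn_deg V).-1)%N.
  by rewrite !mul1n add1n prednK // eqn_deg_gt0.
apply: dhomogM.
  by rewrite dhomogX /= mdeg1.
by apply: dhomogMn; rewrite dhomogX /= mdeg1.
Qed.

Lemma chart_val_neq0 : chart_val i != 0.
Proof.
have Fi0' := tofrac_neq0 Fi0.
rewrite /chart_val pullM pullXn pullX -exprS; apply: mulf_neq0.
  exact: expf_neq0.
by rewrite invr_eq0; exact: (maps_into_neq0 FWV).
Qed.

(* The value of a derivation on X_l / X_i, by the quotient rule; X_l / X_i
   itself need not be regular on V. *)
Definition chart_coord (E : L -> L) l : L :=
  (E (chart_fn l) * chart_val i - chart_val l * E (chart_fn i)) / chart_val i ^+ 2.

Lemma chart_coord_tangent m l :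
  chart_coord (tangent F i (lift i m)) l = (l == lift i m)%:R.
Proof.
have q0 := tofrac_neq0 (eqn_neq0 V); have X0 := tofrac_neq0 (X_neq0 i).
have Fi0' := tofrac_neq0 Fi0.
have e : chart_fn l = ('X_l)%:F / ('X_i)%:F * chart_fn i.
  by rewrite /chart_fn !tofracM; exact: (frac_rescale _ _ _ X0).
have e' : chart_val l = (tnth F l)%:F / (tnth F i)%:F * chart_val i.
  by rewrite /chart_val !pullM !pullX; exact: (frac_rescale _ _ _ Fi0').
have hz : pullback F (('X_l)%:F / ('X_i)%:F) ((tnth F l)%:F / (tnth F i)%:F).
  by exists 'X_l, 'X_i; rewrite !pullX.
rewrite /chart_coord {1}e.
rewrite (tangentM _ _ hz (comorphism_pullback FWV (chart_fnP i))).
rewrite (tangent_coord _ _ Fi0) e'.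
exact: (quotient_rule_coord _ _ _ chart_val_neq0).
Qed.

(** The fields [tangent F i] are regular on all of W, so [B] expresses them with regular
    coefficients. The inverse change reads the chart coordinates of [B], which may have poles along
    F_i = 0. *)
Lemma frame_change (B : 'I_n -> L -> L) : is_frame phi W B ->
  exists c : 'M[L]_n,
  [/\ forall m p, regular W (c m p),
      forall m a a', phi a a' -> tangent F i (lift i m) a = \sum_p c m p * B p a
    & c *m (\matrix_(p, m) chart_coord (B p) (lift i m)) = 1%:M].
Proof.
move=> [hB span].
have /fin_all_exists [c hc] m : exists c : 'rV[L]_n, (forall p, regular W (c 0 p)) /\
    (forall a a', phi a a' -> tangent F i (lift i m) a = \sum_p c 0 p * B p a).
  by have [c [hc _]] := span _ (tangent_derivation homF FWV i (lift i m)); exists c.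
exists (\matrix_(m, p) c m 0 p); split.
- by move=> m p; rewrite mxE; case: (hc m) => h _; exact: h.
- move=> m a a' haa; case: (hc m) => _ h; rewrite (h _ _ haa).
  by apply: eq_bigr => p _; rewrite mxE.
apply/matrixP => m m'; rewrite !mxE.
rewrite -[RHS]/((m == m')%:R) -(inj_eq (@lift_inj _ i)) eq_sym.
rewrite -chart_coord_tangent /chart_coord; case: (hc m) => _ h.
rewrite !(h _ _ (chart_fnP _)) mulr_suml mulr_sumr -sumrB mulr_suml.
by apply: eq_bigr => p _; rewrite !mxE /chart_coord quotient_rule_scale.
Qed.

Lemma chart_coord_inloc E l : is_derivation phi W E ->
  exists m, inloc (eqn W) (chart_coord E l * (tnth F i)%:F ^+ m).
Proof.
(* The denominator is the square of [chart_val i], and [chart_val i] divides F_i^(deg V), with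
   quotient q(F). *)
move=> [Er _ _ _]; exists (eqn_deg V + eqn_deg V)%N.
have Fi0' := tofrac_neq0 Fi0; have Q0 := maps_into_neq0 FWV.
have hval l' : regular W (chart_val l').
  exact: (comorphism_regular homF FWV (chart_fnP l')).
have eF : (tnth F i)%:F ^+ eqn_deg V = chart_val i * pull F q.
  rewrite /chart_val (divfK Q0) pullM pullXn pullX -exprS prednK //.
  exact: eqn_deg_gt0.
rewrite exprD eF /chart_coord; set N := (X in X / _).
rewrite (clear_denominator _ _ chart_val_neq0).
apply: inlocM; last by rewrite pullE -tofracM; exact: inlocF.
rewrite /N; apply: regular_inloc; apply: regularD.
  by apply: regularM; [exact: (Er _ _ (chart_fnP l)) | exact: hval].
rewrite -mulNr -mulN1r -tofrac1 -tofracN -mpolyC1 -mpolyCN.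
apply: regularM; last exact: (Er _ _ (chart_fnP i)).
by apply: regularM; [exact: regularC | exact: hval].
Qed.

End ChangeOfFrame.
End Frames.

(** * The determinant of the differential *)

Lemma jacobian_entry (A : fieldType) (x f df dl fl : A) : f != 0 ->
  x * (dl * f - fl * df) / f ^+ 2 = x / f * (dl - fl / f * df).
Proof. by move=> f0; field. Qed.

Lemma schur_ratio (A : fieldType) (x f e s J : A) n : f != 0 -> e * e = 1 ->
  x * J = f * e * s -> (x / f) ^+ n * s = e * (x / f) ^+ n.+1 * J.
Proof.
move=> f0 ee eJ; have -> : s = e * (x * J) / f.
  have -> : e * (x * J) / f = e * e * s * (f / f) by rewrite eJ; ring.
  by rewrite ee divff // mulr1 mul1r.
by rewrite exprS; ring.
Qed.

(** Read [x] as X_j, [f] as F_i, [M] as the determinant in given frames, and [b], [z] as the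
    determinants relating them to the chart frames. Up to a power of X_j, the poles of r J / M then
    come only from [r], [b] and [z]. *)
Lemma multiple_of_det (A : fieldType) (x f e r b z J M : A) N :
  f != 0 -> M != 0 -> e * e = 1 -> b * M * z = e * (x / f) ^+ N * J ->
  r * J / M * x ^+ N = r * b * z * e * f ^+ N.
Proof.
move=> f0 M0 ee eq.
have e1 : x ^+ N * J = e * f ^+ N * (b * M * z).
  have -> : x ^+ N = (x / f) ^+ N * f ^+ N by rewrite -exprMn divfK.
  have -> : e * f ^+ N * (b * M * z) = e * e * ((x / f) ^+ N * f ^+ N * J).
    by rewrite eq; ring.
  by rewrite ee mul1r.
have -> : r * J / M * x ^+ N = r * (x ^+ N * J) / M by ring.
have -> : r * (x ^+ N * J) / M = r * b * z * e * f ^+ N * (M / M) by rewrite e1; ring.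
by rewrite divff // mulr1.
Qed.

Lemma clear_chart_poles (A : fieldType) (x f e r J s h g : A) N k :
  f != 0 -> J != 0 -> s = r * (e * (x / f) ^+ N * J) -> r * (h * x * f) ^+ k = g ->
  s / J * (f * x) ^+ (k + N) * h ^+ k = g * e * (x ^+ N) ^+ 2.
Proof.
move=> f0 J0 -> <-.
have e1 : x ^+ N = (x / f) ^+ N * f ^+ N by rewrite -exprMn divfK.
have -> : r * (e * (x / f) ^+ N * J) / J = r * (e * (x / f) ^+ N) by rewrite mulrA mulfK.
set a := (x / f) ^+ N in e1 *.
rewrite exprD !exprMn expr2 [X in _ = _ * (X * _)]e1.
by clear e1; move: a (x ^+ N) (f ^+ N) => a X Y; ring.
Qed.

Section Main.
Variables (K : fieldType) (n : nat).
Local Notation R := {mpoly K[n.+1]}.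
Local Notation L := {fraction R}.
Local Notation "x %:F" := (@FracField.tofrac R x).

(** The identity map of P^n. Vector fields are derivations along it, so the frames of TX are a
    special case of those of the pulled-back bundle. *)
Definition coords : (n.+1).-tuple R := [tuple 'X_i | i < n.+1].

Lemma tnth_coords i : tnth coords i = 'X_i.
Proof. by rewrite tnth_mktuple. Qed.

Lemma pull_coords g : pull coords g = g%:F.
Proof. by rewrite pullE comp_mpoly_id. Qed.

Lemma coords_homog i : tnth coords i \is 1.-homog.
Proof. by rewrite tnth_coords dhomogX /= mdeg1. Qed.

Lemma comorphism_coords (W : basic_open K n) a a' :
  comorphism coords W a a' <-> id_regular W a a'.
Proof.
split=> [[k [g [hg -> ->]]]|[[k [g [hg ->]]] ->]]; last first.
  by exists k, g; rewrite -!pullE !pull_coords.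
by rewrite -!pullE !pull_coords; split=> //; exists k, g.
Qed.

Lemma maps_into_coords (W : basic_open K n) : maps_into coords W W.
Proof. by exists 1, 1; rewrite expr1 mul1r comp_mpoly_id. Qed.

Lemma is_derivation_ext (phi psi : L -> L -> Prop) (W : basic_open K n) E :
  (forall a a', phi a a' <-> psi a a') -> is_derivation phi W E -> is_derivation psi W E.
Proof.
move=> e [h1 h2 h3 h4]; split=> //.
- by move=> a a' /e; exact: h1.
- by move=> a a' b b' /e ha /e; exact: h3 ha.
by move=> a a' b b' /e ha /e; exact: h4 ha.
Qed.

Lemma is_frame_ext (phi psi : L -> L -> Prop) (W : basic_open K n) B :
  (forall a a', phi a a' <-> psi a a') -> is_frame phi W B -> is_frame psi W B.
Proof.
move=> e [hB span]; split=> [i|E hE]; first exact: (is_derivation_ext e (hB i)).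
have hE' : is_derivation phi W E by apply: (is_derivation_ext _ hE) => a a'; split=> /e.
have [c [[cr ce] cu]] := span _ hE'.
exists c; split; first by split=> // a a' /e; exact: ce.
by move=> c' [cr' ce']; apply: cu; split=> // a a' /e; exact: ce'.
Qed.

Lemma pullback_coords g b : b != 0 -> pullback coords (g%:F / b%:F) (g%:F / b%:F).
Proof.
by move=> b0; exists g, b; rewrite !pull_coords; split=> //; exact: tofrac_neq0.
Qed.

Variables (F : (n.+1).-tuple R) (d : nat).
Hypothesis homF : forall i, tnth F i \is d.-homog.

Definition jac_entry (j i : 'I_n.+1) (k l : 'I_n) : L :=
  tangent coords j (lift j k) ((tnth F (lift i l))%:F / (tnth F i)%:F).

(** Pivot at entry [(i, j)] of the Cramer matrix, which is F_i. The entries dF_l - (F_l / F_i) dF_i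
    of the Schur complement are, up to the factor X_j / F_i, the derivatives of F_l / F_i. The [n]
    rows give (X_j / F_i)^n, and X_j J divided by the pivot gives one more factor. *)
Lemma det_jac_entry (J : R) i j : tnth F i != 0 ->
  'X_j * J = \det (cramer_mx (tnth F) j) ->
  \det (\matrix_(k, l) jac_entry j i k l) =
  (-1) ^+ (i + j) * (('X_j)%:F / (tnth F i)%:F) ^+ n.+1 * J%:F.
Proof.
move=> Fi0 eJ; have Fi0' := tofrac_neq0 Fi0.
set M := map_mx (@FracField.tofrac R) (cramer_mx (tnth F) j).
have Mj l : M l j = (tnth F l)%:F by rewrite !mxE eqxx.
have Ml l k : M l (lift j k) = ((tnth F l)^`M(lift j k))%:F.
  by rewrite !mxE eq_sym (negPf (neq_lift _ _)).
have Mij : M i j != 0 by rewrite Mj.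
have := det_schur Mij; rewrite det_map_mx -eJ rmorphM Mj.
set S := \matrix_(_, _) _ => eS.
have -> : \matrix_(k, l) jac_entry j i k l = (('X_j)%:F / (tnth F i)%:F) *: S^T.
  apply/matrixP=> k l.
  rewrite [LHS]mxE [RHS]mxE [S^T _ _]mxE [S _ _]mxE !Mj !Ml /jac_entry.
  have P0 : pull coords (tnth F i) != 0 by rewrite pull_coords; exact: Fi0'.
  rewrite (tangentE _ _ _ P0) !pull_coords tnth_coords.
  exact: (jacobian_entry _ _ _ _ Fi0').
rewrite detZ det_tr; apply: (schur_ratio _ Fi0' _ eS).
by rewrite -exprMn mulrNN mulr1 expr1n.
Qed.

(** Three matrices are composed: the chart fields expanded in [D], then the differential, then the
    chart coordinates of [E]. Only the last may have poles, along F_i = 0; the outer two have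
    one-sided inverses, so their determinants are nonzero. *)
Lemma frame_transition (W V : basic_open K n) D E M i j :
  maps_into F W V -> tnth F i != 0 ->
  is_frame (id_regular W) W D -> is_frame (comorphism F V) W E ->
  differential_matrix F W V D E M ->
  exists b z : L, [/\ inloc (eqn W) b, (exists m, inloc (eqn W) (z * (tnth F i)%:F ^+ m)),
    b != 0, z != 0 & \det (\matrix_(k, l) jac_entry j i k l) = b * \det M * z].
Proof.
move=> FWV Fi0 frD frE [Mr dM].
have frD' : is_frame (comorphism coords W) W D.
  by apply: (is_frame_ext _ frD) => a a'; split=> /comorphism_coords.
have Xj0 : tnth coords j != 0 by rewrite tnth_coords X_neq0.
have [b [br be bY]] := frame_change coords_homog (maps_into_coords W) Xj0 frD'.
have [c [cr ce cZ]] := frame_change homF FWV Fi0 frE.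
set Z := (X in c *m X = _) in cZ; set Y := (X in b *m X = _) in bY.
exists (\det b), (\det Z); split.
- by apply: inloc_det => k l; exact: (regular_inloc (br k l)).
- have hZ p l : exists m, inloc (eqn W) (Z p l * (tnth F i)%:F ^+ m).
    by rewrite mxE; apply: (chart_coord_inloc homF FWV Fi0); case: frE.
  exact: inloc_det_pole.
- apply/eqP => b0; have := congr1 determinant bY; rewrite det_mulmx b0 mul0r det1.
  by move/eqP; rewrite eq_sym oner_eq0.
- apply/eqP => z0; have := congr1 determinant cZ; rewrite det_mulmx z0 mulr0 det1.
  by move/eqP; rewrite eq_sym oner_eq0.
rewrite -[\det M]det_tr -!det_mulmx; congr (\det _); apply/matrixP => k l.
rewrite mxE /jac_entry.
set v := chart_val F V i i.
have v0 : v != 0 := chart_val_neq0 FWV Fi0.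
have q0 : eqn V \mPo F != 0.
  by rewrite -tofrac_eq0 -pullE; exact: (maps_into_neq0 FWV).
have pbv l' : pullback coords (chart_val F V i l') (chart_val F V i l').
  by rewrite /chart_val !pullE; exact: (pullback_coords _ q0).
have De l' : tangent coords j (lift j k) (chart_val F V i l') =
    \sum_p (b *m M^T) k p * E p (chart_fn V i l').
  have hl := chart_fnP F V i l'.
  have hr := comorphism_regular homF FWV hl.
  rewrite (be k _ (chart_val F V i l')); last by apply/comorphism_coords.
  under eq_bigr => m _ do rewrite (dM m _ _ hl) mulr_sumr.
  rewrite exchange_big /=; apply: eq_bigr => p _; rewrite mxE mulr_suml.
  by apply: eq_bigr => m _; rewrite [M^T _ _]mxE mulrA.
have vl : chart_val F V i (lift i l) = (tnth F (lift i l))%:F / (tnth F i)%:F * v.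
  rewrite /v /chart_val !pullM !pullX; exact: (frac_rescale _ _ _ (tofrac_neq0 Fi0)).
(* F_l / F_i need not come from O(V), so it is differentiated as a ratio of two chart values. *)
transitivity ((tangent coords j (lift j k) (chart_val F V i (lift i l)) * v -
   chart_val F V i (lift i l) * tangent coords j (lift j k) v) / v ^+ 2).
  rewrite vl (tangentM _ _ (pullback_coords _ Fi0) (pbv i)).
  by rewrite (quotient_rule_coord _ _ _ v0).
rewrite !De [RHS]mxE mulr_suml mulr_sumr -sumrB mulr_suml.
by apply: eq_bigr => p _; rewrite [Z _ _]mxE /chart_coord quotient_rule_scale.
Qed.

End Main.

(** * Comparison of the two schemes *)

Lemma pole_rearrange (A : comNzRingType) (S x f b r z e : A) N m :
  S * x ^+ N = r * b * z * e * f ^+ N ->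
  S * (f * x) ^+ (N + m) = r * b * e * (z * f ^+ m) * (f ^+ N * f ^+ N * x ^+ m).
Proof.
move=> eS; rewrite exprMn !exprD.
have -> : S * (f ^+ N * f ^+ m * (x ^+ N * x ^+ m)) =
          S * x ^+ N * (f ^+ N * f ^+ m * x ^+ m).
  by ring.
by rewrite eS; ring.
Qed.

Section Compare.
Variables (K : fieldType) (n : nat).
Local Notation R := {mpoly K[n.+1]}.
Local Notation L := {fraction R}.
Local Notation "x %:F" := (@FracField.tofrac R x).

(** Degree and poles separate as in [regularP]. The cofactor [r] is not of degree zero in general:
    it absorbs the degree of [p]. *)
Lemma vanishing_schemeP (p : R) N (W : basic_open K n) s : p \is N.-homog ->
  vanishing_scheme p W s <-> deg0 s /\ exists2 r, inloc (eqn W) r & s = r * p%:F.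
Proof.
move=> hp; have h0 := eqn_neq0 W; have hh := eqn_homog W.
have h0' k : (eqn W)%:F ^+ k != 0 by rewrite expf_neq0 // tofrac_neq0.
split=> [[k [c [hg es]]]|[[m [a [b [ha hb b0 es]]]] [r [k [c er]] es']]].
  set g := \sum_(i < _) _ in hg es; split.
    exists (k * eqn_deg W)%N, g, (eqn W ^+ k); rewrite expf_neq0 // tofracXn.
    by split=> //; rewrite mulnC; exact: dhomogMn.
  have [c' eg] : exists c', g = c' * p.
    rewrite /g; apply: (big_ind (fun g => exists c', g = c' * p)).
    - by exists 0; rewrite mul0r.
    - by move=> x y [x' ->] [y' ->]; exists (x' + y'); rewrite mulrDl.
    move=> i _; have [Ni|Ni] := eqVneq N i.
      by exists (c i); rewrite pihomog_dE // -Ni.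
    by exists 0; rewrite (pihomog_ne0 Ni hp) mulr0 mul0r.
  exists (c'%:F / (eqn W)%:F ^+ k); first by exists k, c'; rewrite divfK.
  by rewrite es eg tofracM mulrAC.
exists k, (fun _ => c) => g.
have eg : g = c * p.
  by rewrite /g -mulr_sumr -(pihomog_partitionE (leqnn _)).
have esg : s = g%:F / (eqn W)%:F ^+ k.
  by rewrite eg tofracM -er es' mulrAC mulfK.
split=> //.
have ab : a * eqn W ^+ k = g * b.
  by apply: frac_eq; rewrite ?expf_neq0 // -es tofracXn.
rewrite -[(k * _)%N](addKn m); apply: (homog_divisor b0 hb).
by rewrite mulrC -ab; apply: dhomogM => //; rewrite mulnC; exact: dhomogMn.
Qed.

Lemma regular0 (W : basic_open K n) : regular W 0.
Proof. by rewrite -tofrac0 -mpolyC0; exact: regularC. Qed.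

Lemma sub_domain_neq0 (F : (n.+1).-tuple R) (W : basic_open K n) :
  sub_domain F W -> exists i, tnth F i != 0.
Proof.
move=> [k [c e]]; apply/existsP; apply: contraNT (expf_neq0 k (eqn_neq0 W)).
rewrite negb_exists => /forallP F0; rewrite e big1 // => i _.
by move: (F0 i); rewrite negbK => /eqP ->; rewrite mulr0.
Qed.

Lemma inloc_sign (h : R) k : inloc h ((-1) ^+ k).
Proof. by apply: inlocX; rewrite -tofrac1 -tofracN; exact: inlocF. Qed.

Lemma signrMK (A : comNzRingType) k : (-1) ^+ k * (-1) ^+ k = 1 :> A.
Proof. by rewrite -exprMn mulrNN mulr1 expr1n. Qed.

Variables (F : (n.+1).-tuple R) (d N : nat) (J : R).
Hypothesis homF : forall i, tnth F i \is d.-homog.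
Hypothesis homJ : J \is N.-homog.
Hypothesis cramerJ : forall j, 'X_j * J = \det (cramer_mx (tnth F) j).

(** W is covered by the opens X_j F_i <> 0: the F_i have no common zero on W, and the equation of W,
    being of positive degree, lies in the ideal of the X_j. *)
Lemma domain_glue (W : basic_open K n) s : sub_domain F W ->
  (forall i j, tnth F i != 0 ->
     exists m, inloc (eqn W) (s * ((tnth F i)%:F * ('X_j)%:F) ^+ m)) ->
  inloc (eqn W) s.
Proof.
move=> [k [c e]] hs.
have hW : eqn W \is (eqn_deg W).-1.+1.-homog.
  by rewrite prednK ?eqn_deg_gt0 // eqn_homog.
have [c' e'] := homog_lin_comb hW.
apply: (@inloc_glue2 _ _ _ _ c (tnth F) c' (fun j => 'X_j) k 1); rewrite ?expr1 //.
move=> i j; have [Fi0|Fi0] := eqVneq (tnth F i) 0; last exact: hs.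
by exists 1; rewrite Fi0 tofrac0 mul0r expr1 mulr0 -tofrac0; exact: inlocF.
Qed.

Lemma sub_domainS (W W' : basic_open K n) : sub_open W' W -> sub_domain F W ->
  sub_domain F W'.
Proof.
move=> [k [c e]] [l [c' e']]; exists (k * l)%N, (fun i => c ^+ l * c' i).
rewrite exprM e exprMn e' mulr_sumr; apply: eq_bigr => i _; exact: mulrA.
Qed.

Lemma vanishing_critical (W : basic_open K n) s : sub_domain F W ->
  vanishing_scheme J W s -> critical_scheme F W s.
Proof.
move=> FW /(vanishing_schemeP _ _ homJ) [s0 [r hr es]]; split.
  by apply/regularP; split=> //; rewrite es; apply: inlocM => //; exact: inlocF.
move=> W' V D E M W'W FWV frD frE dM.
have FW' := sub_domainS W'W FW.
have {}hr : inloc (eqn W') r.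
  by case: W'W => k [c e]; exact: (inloc_sub (eqn_neq0 W') e hr).
(* The specialized J* may vanish, for example at F_i = X_i^p in characteristic p > 0 with n >= 1;
   then [\det M] cannot be inverted, but [s] is 0. *)
have [J0|J0] := eqVneq J 0.
  by exists 0; rewrite mul0r es J0 tofrac0 mulr0; split=> //; exact: regular0.
have J0' := tofrac_neq0 J0; have [i0 Fi0] := sub_domain_neq0 FW.
have M0 : \det M != 0.
  have [b [z [_ _ _ _ eb]]] := frame_transition homF 0 FWV Fi0 frD frE dM.
  have := det_jac_entry Fi0 (cramerJ 0); rewrite eb => e1.
  apply/eqP => detM0; move/eqP: e1; rewrite detM0 mulr0 mul0r eq_sym.
  apply/negP; apply: mulf_neq0 J0'; apply: mulf_neq0; first by rewrite signr_eq0.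
  apply: expf_neq0; apply: mulf_neq0; first exact: (tofrac_neq0 (X_neq0 K 0)).
  by rewrite invr_eq0; exact: (tofrac_neq0 Fi0).
(* The quotient has degree zero because all entries of [M] do; its poles are examined chart by
   chart. *)
exists (s / \det M); rewrite divfK //; split=> //; apply/regularP; split; last first.
  apply: deg0M => //; apply: deg0V; apply: deg0_det => k l.
  by case: dM => Mr _; exact: (regular_deg0 (Mr k l)).
apply: (domain_glue FW') => i j Fi.
have [b [z [hb [m hz] _ _ eb]]] := frame_transition homF j FWV Fi frD frE dM.
have := det_jac_entry Fi (cramerJ j); rewrite eb => e1.
have := multiple_of_det r (tofrac_neq0 Fi) M0 (signrMK _ _) e1; rewrite -es => e2.
exists (n.+1 + m)%N; rewrite (pole_rearrange m e2).
apply: inlocM; last by rewrite -!tofracXn -!tofracM; exact: inlocF.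
apply: inlocM hz; apply: inlocM; last exact: inloc_sign.
exact: inlocM hr hb.
Qed.

Lemma critical_vanishing (W : basic_open K n) s : sub_domain F W ->
  critical_scheme F W s -> vanishing_scheme J W s.
Proof.
move=> FW [sr crit]; apply/(vanishing_schemeP _ _ homJ).
split; first exact: regular_deg0 sr.
(* One well-chosen test per chart suffices: W' is W with X_j F_i <> 0, V is X_i <> 0, and the chart
   fields themselves are the frames. *)
have local_multiple i j : tnth F i != 0 -> exists k (g : R), exists2 r,
    r * ((eqn W)%:F * ('X_j)%:F * (tnth F i)%:F) ^+ k = g%:F &
    s = r * ((-1) ^+ (i + j) * (('X_j)%:F / (tnth F i)%:F) ^+ n.+1 * J%:F).
  move=> Fi0; have Fi0' := tofrac_neq0 Fi0.
  have Xh k : ('X_k : R) \is 1.-homog by rewrite dhomogX /= mdeg1.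
  have neq0 : eqn W * 'X_j * tnth F i != 0.
    by apply: mulf_neq0 Fi0; apply: mulf_neq0 (X_neq0 K j); exact: eqn_neq0.
  have hom : eqn W * 'X_j * tnth F i \is (eqn_deg W + 1 + d).-homog.
    by apply: dhomogM (homF i); apply: dhomogM (Xh j); exact: eqn_homog.
  have pos : (0 < eqn_deg W + 1 + d)%N by rewrite addn1.
  pose W' := BasicOpen pos neq0 hom.
  pose V := BasicOpen (ltn0Sn 0) (X_neq0 K i) (Xh i).
  have FWV : maps_into F W' V.
    by exists 1, (eqn W * 'X_j); rewrite expr1 /= comp_mpolyXU -tnth_nth.
  have W'W : sub_open W' W.
    by exists 1, ('X_j * tnth F i); rewrite expr1 /= [RHS]mulrC mulrA.
  have qW' : eqn W' = eqn W * tnth F i * 'X_j by rewrite /= mulrAC.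
  have qV : eqn V = 1 * 'X_i by rewrite mul1r.
  have idX := maps_into_coords W'.
  have frD : is_frame (id_regular W') W' (fun k => tangent (coords K n) j (lift j k)).
    apply: (is_frame_ext (comorphism_coords W')).
    exact: (tangent_frame (@coords_homog K n) idX qW').
  have frE := tangent_frame homF FWV qV.
  have hz l := adapted_coord FWV qV l.
  have dM : differential_matrix F W' V (fun k => tangent (coords K n) j (lift j k))
      (fun l => tangent F i (lift i l)) (\matrix_(k, l) jac_entry F j i k l)^T.
    split=> [l k|k a a' haa].
      rewrite !mxE; set v := (tnth F (lift i l))%:F / (tnth F i)%:F.
      have hv : comorphism (coords K n) W' v v.
        apply/comorphism_coords; split=> //.
        exact: (comorphism_regular homF FWV (hz _)).
      exact: (tangent_regular (@coords_homog K n) idX _ _ hv).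
    (* The vector field composed with the comorphism is a derivation along f; its expansion in the
       chart frame is the [k]-th column of the matrix. *)
    have [/(_ k) hD _] := frD.
    rewrite -(comapE FWV haa) -[LHS]/((tangent _ _ _ \o comap F V) a).
    rewrite (derivation_expand homF FWV qV (derivation_comap homF FWV hD) haa).
    by apply: eq_bigr => l _; rewrite !mxE /= (comapE FWV (hz _)).
  have [r [rr es]] := crit W' V _ _ _ W'W FWV frD frE dM.
  rewrite det_tr (det_jac_entry Fi0 (cramerJ j)) in es.
  have [k [g eg]] := regular_inloc rr.
  by exists k, g, r => //; rewrite -eg /= !tofracM.
have [J0|J0] := eqVneq J 0.
  have [i Fi0] := sub_domain_neq0 FW; have [k [g [r _ es]]] := local_multiple i 0 Fi0.
  exists 0; first by rewrite -tofrac0; exact: inlocF.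
  by rewrite es J0 tofrac0 !mulr0.
have J0' := tofrac_neq0 J0; exists (s / J%:F); last by rewrite divfK.
apply: (domain_glue FW) => i j Fi0; have [k [g [r eg es]]] := local_multiple i j Fi0.
(* The exponent [k] clears the poles of [r], and [n.+1] those of (X_j / F_i)^(n+1). *)
exists (k + n.+1)%N, k, (g * (-1) ^+ (i + j) * ('X_j ^+ n.+1) ^+ 2).
rewrite (clear_chart_poles (tofrac_neq0 Fi0) J0' es eg).
by rewrite !tofracM !tofracXn tofracN tofrac1.
Qed.

End Compare.

(** * Specialization *)

Lemma det_homog (A : comNzRingType) n m e (M : 'M[{mpoly A[n]}]_m) :
  (forall i j, M i j \is e.-homog) -> \det M \is (m * e).-homog.
Proof.
move=> hM; rewrite /determinant; apply: rpred_sum => s _; rewrite rpredMsign.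
have -> : (m * e = \sum_(i < m) e)%N by rewrite sum_nat_const card_ord.
apply: (big_ind2 (fun (p : {mpoly A[n]}) k => p \is k.-homog)) => //.
- exact: dhomog1.
- by move=> x1 k1 x2 k2; exact: dhomogM.
Qed.

Lemma det_cramer_homog (A : comNzRingType) n d (F : 'I_n.+1 -> {mpoly A[n.+1]}) j :
  (forall i, F i \is d.-homog) -> \det (cramer_mx F j) \is (d + n * d.-1).-homog.
Proof.
move=> hF; rewrite (expand_det_col _ j); apply: rpred_sum => l _.
apply: dhomogM; first by rewrite mxE eqxx.
rewrite /cofactor rpredMsign; apply: det_homog => a b.
rewrite mxE mxE mxE eq_sym (negPf (neq_lift _ _)); exact: mderiv_homog.
Qed.

Lemma mderiv_map (A B : nzRingType) (f : {rmorphism A -> B}) n (p : {mpoly A[n]}) i :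
  map_mpoly f p^`M(i) = (map_mpoly f p)^`M(i).
Proof.
apply/mpolyP => m; rewrite mcoeff_map_mpoly !mcoeff_deriv mcoeff_map_mpoly.
exact: raddfMn.
Qed.

Lemma map_mpoly_homog (A B : nzRingType) (f : {rmorphism A -> B}) n d (p : {mpoly A[n]}) :
  p \is d.-homog -> map_mpoly f p \is d.-homog.
Proof.
move=> hp; apply/dhomogP => m; rewrite mcoeff_msupp mcoeff_map_mpoly => fm.
apply: (dhomog_mf hp); rewrite mcoeff_msupp; apply: contraNneq fm => ->.
by rewrite raddf0.
Qed.

Lemma homog0_const (A : nzRingType) n (p : {mpoly A[n]}) :
  p \is 0.-homog -> p = (p@_0%MM)%:MP.
Proof.
move=> hp; apply/mpolyP => m; rewrite mcoeffC.
have [->|m0] := eqVneq m 0%MM; first by rewrite mulr1.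
by rewrite mulr0 (dhomog_nemf_coeff hp) //= mdeg_eq0.
Qed.

Lemma Funiv_homog n d i : @Funiv n d i \is d.-homog.
Proof.
apply: rpred_sum => m _; apply: rpredZ; rewrite dhomogX /=; exact: (valP m).
Qed.

Lemma mcoeff_form (A : comNzRingType) n d
    (u : {m : 'X_{1..n < d.+1} | mdeg m == d} -> A) m :
  (\sum_m' u m' *: 'X_[val m'])@_(val (val m)) = u m.
Proof.
rewrite raddf_sum /= (bigD1 m) //= mcoeffZ mcoeffX eqxx mulr1.
rewrite big1 ?addr0 // => m' m'm; rewrite mcoeffZ mcoeffX.
have /negPf -> : val (val m') != val (val m).
  by apply: contraNneq m'm => e; apply/eqP/val_inj/val_inj.
by rewrite mulr0.
Qed.

Section Specialization.
Variables (K : fieldType) (n d : nat) (F : (n.+1).-tuple {mpoly K[n.+1]}).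
Hypothesis homF : forall i, tnth F i \is d.-homog.

Lemma theta_Funiv i : theta F (@Funiv n d i) = tnth F i.
Proof.
apply/mpolyP => m; rewrite /theta mcoeff_map_mpoly.
have [md|md] := eqVneq (mdeg m) d; last first.
  by rewrite !(@dhomog_nemf_coeff _ _ mdeg d) ?raddf0 ?Funiv_homog.
have mb : (mdeg m < d.+1)%N by rewrite md.
have mv : mdeg (BMultinom mb) == d by apply/eqP.
have /= := mcoeff_form (fun m => uvar (i, m)) (exist _ (BMultinom mb) mv).
rewrite -/(Funiv d i) => ->.
by rewrite /uvar mmapX mmap1U enum_rankK.
Qed.

(** This identity still determines [theta F J] when the characteristic of [K] divides [d]. *)
Lemma theta_cramer (J : {mpoly (Zu n d)[n.+1]}) j :
  'X_j * J = \det (cramer_mx (@Funiv n d) j) -> 'X_j * theta F J = \det (cramer_mx (tnth F) j).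
Proof.
move=> /(congr1 (theta F)); rewrite /theta rmorphM /= map_mpolyX -det_map_mx => ->.
congr (\det _); apply/matrixP => l k; rewrite [LHS]mxE [RHS]mxE mxE.
case: eqP => _; first exact: theta_Funiv.
rewrite -theta_Funiv; exact: mderiv_map.
Qed.

End Specialization.

(** Powers of a linear form bring every homogeneous component of [p] to degree 0. No homogeneity of
    [p] is assumed, since a competing solution of (b) is not known to be homogeneous. *)
Lemma vanishing_scheme_all (K : fieldType) n (p : {mpoly K[n.+1]}) (W : basic_open K n) :
  eqn_deg W = 1%N -> (forall s, vanishing_scheme p W s -> s = 0) -> p = 0.
Proof.
move=> W1 p0; rewrite [p](@pihomog_partitionE _ _ mdeg _ p (leqnn _)) big1 // => e _.
have he : pihomog mdeg e p \is (e * eqn_deg W).-homog by rewrite W1 muln1 pihomogP.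
have : vanishing_scheme p W
    (FracField.tofrac (pihomog mdeg e p) / FracField.tofrac (eqn W) ^+ e).
  exists e, (fun i => (i == e)%:R) => g.
  have -> : g = pihomog mdeg e p; last by split.
  rewrite /g (bigD1 e) //= eqxx mul1r big1 ?addr0 // => i ie.
  by rewrite (negPf ie) mul0r.
move=> /p0 /eqP; rewrite mulf_eq0 tofrac_eq0 invr_eq0 expf_eq0 tofrac_eq0.
by rewrite (negPf (eqn_neq0 W)) andbF orbF => /eqP.
Qed.

Lemma mmap_int_rmorph (A : comNzRingType) N (f : {rmorphism {mpoly int[N]} -> A})
    (h : 'I_N -> A) p :
  (forall k, h k = f 'X_k) -> mmap (intr : int -> A) h p = f p.
Proof.
move=> hf; rewrite [in RHS](mpolyE p) rmorph_sum; apply: eq_bigr => e _ /=.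
rewrite -mul_mpolyC rmorphM; congr (_ * _).
  by rewrite -[in RHS](intz p@_e) !rmorph_int.
rewrite mpolyXE_id rmorph_prod; apply: eq_bigr => k _.
by rewrite rmorphXn hf.
Qed.

(** * Specialization at the generic tuple *)

Section GenericPoint.
Variables (n d : nat) (K : fieldType).
Variable f : {rmorphism {mpoly int[#|uidx n d|]} -> K}.

Definition generic_tuple : (n.+1).-tuple {mpoly K[n.+1]} :=
  [tuple map_mpoly f (Funiv d i) | i < n.+1].

Lemma tnth_generic i : tnth generic_tuple i = map_mpoly f (Funiv d i).
Proof. by rewrite tnth_mktuple. Qed.

Lemma generic_homog i : tnth generic_tuple i \is d.-homog.
Proof. by rewrite tnth_generic; apply: map_mpoly_homog; exact: Funiv_homog. Qed.

Lemma generic_coeff (u : uidx n d) :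
  (tnth generic_tuple u.1)@_(val (val u.2)) = f (uvar u).
Proof.
rewrite tnth_generic mcoeff_map_mpoly; congr (f _).
by case: u => i m; exact: (mcoeff_form (fun m => uvar (i, m))).
Qed.

Lemma mcoeff_theta_generic P m : (theta generic_tuple P)@_m = f P@_m.
Proof.
rewrite /theta mcoeff_map_mpoly; apply: mmap_int_rmorph => k.
by rewrite /= generic_coeff /uvar enum_valK.
Qed.

Lemma theta_generic_inj (P : {mpoly (Zu n d)[n.+1]}) :
  injective f -> theta generic_tuple P = 0 -> P = 0.
Proof.
move=> fI e; apply/mpolyP => m; apply: fI.
by rewrite -mcoeff_theta_generic e !mcoeff0 raddf0.
Qed.
End GenericPoint.

(** A nonzero constant F_i is a unit: its divisors are constants, and it already generates the unit
    ideal on every W. *)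
Lemma const_tuple_rat (K : fieldType) n (F : (n.+1).-tuple {mpoly K[n.+1]}) i :
  (forall i, tnth F i \is 0.-homog) -> tnth F i != 0 ->
  is_rat 0 F /\ forall W, sub_domain F W.
Proof.
move=> homF Fi0; have eF := homog0_const (homF i).
have c0 : (tnth F i)@_0%MM != 0 by apply: contraNneq Fi0 => c0; rewrite eF c0 mpolyC0.
split; first split=> //; first by exists i.
  move=> p /(_ i) [c ec].
  have c0' : c != 0 by apply: contraNneq Fi0 => c0'; rewrite ec c0' mul0r.
  have p0 : p != 0 by apply: contraNneq Fi0 => p0; rewrite ec p0 mulr0.
  exists p@_0%MM; apply: msize1_polyC.
  have := congr1 (mmeasure mdeg) ec; rewrite msizeM // eF msizeC c0.
  rewrite (mpolySpred mdeg c0') (mpolySpred mdeg p0) addSn addnS /= => -[].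
  by move=> /esym/eqP; rewrite addn_eq0 => /andP[_ /eqP ->].
move=> W; exists 0, (fun k => if k == i then (((tnth F i)@_0%MM)^-1)%:MP else 0).
rewrite expr0 (bigD1 i) //= eqxx big1 ?addr0 => [|k ki]; last first.
  by rewrite (negPf ki) mul0r.
by rewrite {2}eF -mpolyCM mulVf.
Qed.

Lemma degree0_generic_vanishing n (J : {mpoly (Zu n 0)[n.+1]}) :
  (forall (K : fieldType) (F : (n.+1).-tuple {mpoly K[n.+1]}), is_rat 0 F ->
     forall W s, sub_domain F W -> vanishing_scheme (theta F J) W s -> s = 0) ->
  J = 0.
Proof.
pose Z := {mpoly int[#|uidx n 0|]} => van.
pose f : {rmorphism Z -> {fraction Z}} := @FracField.tofrac Z.
have fI : injective f by move=> x y /eqP; rewrite tofrac_eq => /eqP.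
pose F := generic_tuple f.
have m0 : (mdeg (0%MM : 'X_{1..n.+1}) < 1)%N by rewrite mdeg0.
have m0' : mdeg (BMultinom m0) == 0 by rewrite /= mdeg0.
have F0 : tnth F 0 != 0.
  (* The constant term of F_0 is a variable of Z[u], hence nonzero. *)
  have /= e := generic_coeff f (0, exist _ (BMultinom m0) m0').
  apply/eqP => F0; move/eqP: e; rewrite -/F F0 mcoeff0 eq_sym.
  by rewrite tofrac_eq0 -msize_poly_eq0 msizeX.
have [ratF domF] := const_tuple_rat (generic_homog f) F0.
apply: (theta_generic_inj fI).
have X1 : ('X_0 : {mpoly {fraction Z}[n.+1]}) \is 1.-homog by rewrite dhomogX /= mdeg1.
pose W := BasicOpen (ltn0Sn 0) (X_neq0 _ 0) X1.
by apply: (@vanishing_scheme_all _ _ _ W) => // s; exact: (van _ _ ratF W s (domF W)).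
Qed.

Theorem theorem4p1 (n d : nat) (hn : (1 <= n)%N) :
  exists! Jstar : {mpoly (Zu n d)[n.+1]},
    Jgen n d = d%:R * Jstar /\
    (forall (K : fieldType) (F : (n.+1).-tuple {mpoly K[n.+1]}),
       is_rat d F ->
       same_subscheme (sub_domain F)
         (critical_scheme F) (vanishing_scheme (theta F Jstar))).
Proof.
have charZ k : k.+1%:R != 0 :> {mpoly int[#|uidx n d|]}.
  by rewrite -mpolyC_nat mpolyC_eq0 Num.Theory.pnatr_eq0.
have [J [Ja Jp]] := reduced_jacobian hn charZ (@Funiv_homog n d).
have schemeJ (K : fieldType) (F : (n.+1).-tuple {mpoly K[n.+1]}) : is_rat d F ->
    same_subscheme (sub_domain F) (critical_scheme F) (vanishing_scheme (theta F J)).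
  move=> [homF _ _] W FW s.
  have cramerJ j : 'X_j * theta F J = \det (cramer_mx (tnth F) j) by exact: theta_cramer.
  (* For [d > 0] this is the expected degree (n+1)(d-1), read off from X_0 J* = B_0. *)
  have homJ : theta F J \is ((d + n * d.-1) - 1).-homog.
    apply: (homog_divisor (X_neq0 K 0)); first by rewrite dhomogX /= mdeg1.
    by rewrite cramerJ; exact: det_cramer_homog.
  split; first exact: (critical_vanishing homF homJ cramerJ FW).
  exact: (vanishing_critical homF homJ cramerJ FW).
exists J; split; first by split.
move=> J' [Ja' schemeJ']; case: (posnP d) => [d0|d0]; last first.
  have e0 : d%:R != 0 :> {mpoly {mpoly int[#|uidx n d|]}[n.+1]}.
    by rewrite -mpolyC_nat mpolyC_eq0; have := charZ d.-1; rewrite prednK.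
  by apply: (mulfI e0); rewrite -[LHS]Ja.
subst d.
have J0 : J = 0.
  have := Jp 0; rewrite (det_cramer_const _ hn (@Funiv_homog n 0)) => /eqP.
  by rewrite mulf_eq0 -msize_poly_eq0 msizeX => /eqP.
(* Both solutions cut out the critical scheme, and the one already found is 0, so the ideal defined
   by [J'] is zero at every [F]. *)
rewrite J0; apply/esym/degree0_generic_vanishing => K F ratF W s FW.
move/(schemeJ' _ _ ratF W FW s)/(schemeJ _ _ ratF W FW s).
have -> : theta F J = 0 by rewrite J0; exact: raddf0.
have hom0 : (0 : {mpoly K[n.+1]}) \is 0.-homog by exact: dhomog0.
move=> /(vanishing_schemeP _ _ hom0) [_ [r _ ->]].
by rewrite tofrac0 mulr0.
Qed.
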